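(* There is an absolute constant $C>0$ such that the following holds. Let $\gamma\in(0,1)$, $\xi=\frac{1-\gamma}{2n}$, $\delta\in(0,1)$, and let $\widehat\pi$ be an optimal policy of the discounted MDP $(\widehat P,\widetilde r,\gamma)$. Then with probability at least $1-\delta$, $$\|V^{\widehat\pi}_\gamma-V^\star_\gamma\|_\infty\le\frac{1}{1-\gamma}\sqrt{\frac{C\log^3\!\big(\frac{SAn}{(1-\gamma)\delta}\big)}{n}\Big(\|V^\star_\gamma\|_{\mathrm{sp}}+\min\{\|\widehat V^{\widehat\pi}_\gamma\|_{\mathrm{sp}},\|V^{\widehat\pi}_\gamma\|_{\mathrm{sp}}\}+1\Big)} .$$
   Context: $\mathcal S$ finite with $S$ states, $\mathcal A$ finite with $A$ actions; transition kernel $P$; known reward $r:\mathcal S\times\mathcal A\to[0,1]$. Policies stationary Markov; $P_\pi,r_\pi$ induced matrix/reward. Empirical kernel $\widehat P$: $n$ i.i.d. samples from each $P(\cdot|s,a)$, independent across pairs, $\widehat P(s'|s,a)$ = fraction equal to $s'$. Perturbed reward $\widetilde r=r+\Delta$, $\Delta(s,a)$ i.i.d. Uniform$[0,\xi]$ independent of the samples. $V^\pi_\gamma=(I-\gamma P_\pi)^{-1}r_\pi$, $V^\star_\gamma=\max_\pi V^\pi_\gamma$ (true model, reward $r$); $\widehat V^{\pi}_\gamma=(I-\gamma\widehat P_\pi)^{-1}r_\pi$ (empirical kernel, unperturbed reward). An optimal policy of $(\widehat P,\widetilde r,\gamma)$ maximizes $(I-\gamma\widehat P_\pi)^{-1}\widetilde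 r_\pi$ elementwise. $\|x\|_{\mathrm{sp}}=\max x-\min x$. *)

(* Defs.v *)
From HB Require Import structures.
From mathcomp Require Import all_boot all_order all_algebra.
From mathcomp Require Import all_classical all_reals all_analysis.
Set Implicit Arguments. Unset Strict Implicit. Unset Printing Implicit Defensive.
Import Order.TTheory GRing.Theory Num.Theory.
Local Open Scope ring_scope.
Local Open Scope classical_set_scope.

Section MDP.
Variables (R : realType) (S A : nat).

Definition is_kernel (K : 'I_S -> 'I_A -> 'I_S -> R) : Prop :=
  (forall s a s', 0 <= K s a s') /\ (forall s a, \sum_(s' < S) K s a s' = 1).

Definition is_policy (pi : 'I_S -> 'I_A -> R) : Prop :=
  (forall s a, 0 <= pi s a) /\ (forall s, \sum_(a < A) pi s a = 1).

Definition Pmat (K : 'I_S -> 'I_A -> 'I_S -> R) (pi : 'I_S -> 'I_A -> R)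
  : 'M[R]_S := \matrix_(s, s') \sum_(a < A) pi s a * K s a s'.

Definition rvec (rw : 'I_S -> 'I_A -> R) (pi : 'I_S -> 'I_A -> R) : 'cV[R]_S :=
  \col_s \sum_(a < A) pi s a * rw s a.

Definition value (K : 'I_S -> 'I_A -> 'I_S -> R) (rw : 'I_S -> 'I_A -> R)
  (gamma : R) (pi : 'I_S -> 'I_A -> R) : 'cV[R]_S :=
  invmx (1%:M - gamma *: Pmat K pi) *m rvec rw pi.

Definition Vstar (K : 'I_S -> 'I_A -> 'I_S -> R) (rw : 'I_S -> 'I_A -> R)
  (gamma : R) : 'cV[R]_S :=
  \col_s sup [set (value K rw gamma pi) s 0 | pi in is_policy].

Definition optimal (K : 'I_S -> 'I_A -> 'I_S -> R) (rw : 'I_S -> 'I_A -> R)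
  (gamma : R) (pi : 'I_S -> 'I_A -> R) : Prop :=
  is_policy pi /\
  forall pi', is_policy pi' -> forall s, (value K rw gamma pi') s 0 <= (value K rw gamma pi) s 0.

Definition supnorm (v : 'cV[R]_S) : R := \big[Num.max/0]_(s < S) `|v s 0|.

(* ||v||_sp = max v - min v = max_{s,t} (v s - v t) *)
Definition spnorm (v : 'cV[R]_S) : R :=
  \big[Num.max/0]_(s < S) \big[Num.max/0]_(t < S) (v s 0 - v t 0).

End MDP.

Definition empirical (R : realType) (S A n : nat) (X : 'I_S -> 'I_A -> 'I_n -> 'I_S)
  : 'I_S -> 'I_A -> 'I_S -> R :=
  fun s a s' => (#|[set i : 'I_n | X s a i == s']|)%:R / n%:R.

(* Sampling model on a probability space Pr:
   - each X s a i is distributed as K(.|s,a), each D s a as Uniform[0,xi];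
   - the whole family {X s a i} u {D s a} is mutually independent
     (product rule for every choice of (measurable) sets; subfamilies are
     obtained by choosing the full set). *)
Definition sampling_model (R : realType) (S A n : nat) d (Omega : measurableType d)
  (Pr : probability Omega R) (K : 'I_S -> 'I_A -> 'I_S -> R) (xi : R)
  (X : Omega -> 'I_S -> 'I_A -> 'I_n -> 'I_S) (D : Omega -> 'I_S -> 'I_A -> R) : Prop :=
  (forall s a i s', measurable [set w | X w s a i = s']) /\
  (forall s a, measurable_fun setT (fun w => D w s a)) /\
  (forall s a i s', Pr [set w | X w s a i = s'] = (K s a s')%:E) /\
  (forall s a (B : set R), measurable B ->
     Pr [set w | B (D w s a)] = ((xi^-1)%:E * lebesgue_measure (B `&` `[0%R, xi]%classic))%E) /\
  (forall (F : 'I_S -> 'I_A -> 'I_n -> set 'I_S) (G : 'I_S -> 'I_A -> set R),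
     (forall s a, measurable (G s a)) ->
     Pr [set w | (forall s a i, F s a i (X w s a i)) /\ (forall s a, G s a (D w s a))]
     = ((\prod_(s < S) \prod_(a < A) \prod_(i < n) Pr [set w | F s a i (X w s a i)])
        * (\prod_(s < S) \prod_(a < A) Pr [set w | G s a (D w s a)]))%E).

(* Main.v *)
(** With [H = 1/(1-g)], [V] the true optimal value and [v] the empirical value
    of the chosen policy, the gap is split as [V - vhat] + [vhat - v] +
    [v - U], where [vhat] is the empirical optimal value and [U] the true value
    of the chosen policy; the middle term is at most [xi * H].

    Each outer term is controlled by applying a Bernstein inequality with the
    scale [eta] fixed in advance, [(Phat - P) f <= 2 eta Var f + L / (eta n)],
    and by the maximum principle for the tilted function [F = f + c eta f^2]:
    along the Bellman recursion [f] loses [eta Var f], and the quadratic term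
    gains as much, up to [O(eta span f)].  Thus [F] is a subsolution of the other
    model up to [O(rho)], [rho = sqrt (L span f / n)] once [eta = rho / span f],
    and the total error is [O(H rho)].

    The function [v] depends on the samples.  At a pair [(s, a)] it is replaced by
    the optimal value of the model in which [(s, a)] is terminal with a payoff
    from a grid of mesh [1/n]; this value does not depend on the samples at
    [(s, a)] and is within [1/n] of [v].  Clipping [v] at depth [K] below its
    maximum makes the span of [U] usable in place of the span of [v]: if [K]
    exceeds the span of [U], the tilted [v - U] cannot be maximal where the
    clipping is active. *)
Require Import Defs.
From HB Require Import structures.
From mathcomp Require Import all_boot all_order all_algebra.
From mathcomp Require Import all_classical all_reals all_analysis.
From mathcomp Require Import ring lra.
Set Implicit Arguments. Unset Strict Implicit. Unset Printing Implicit Defensive.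
Import Order.TTheory GRing.Theory Num.Theory.
Local Open Scope ring_scope.

(** * Finite expectations and a one-sided Bernstein inequality at a fixed scale *)

Section Expectation.
Variables (R : realType) (T : finType).
Implicit Types (p f g : T -> R).

Definition expect p f : R := \sum_t p t * f t.

Definition is_dist p := (forall t, 0 <= p t) /\ \sum_t p t = 1.

Lemma eq_expect p f g : f =1 g -> expect p f = expect p g.
Proof. by move=> fg; apply: eq_bigr => t _; rewrite fg. Qed.

Lemma expectD p f g : expect p (fun t => f t + g t) = expect p f + expect p g.
Proof. by rewrite -big_split; apply: eq_bigr => t _; rewrite mulrDr. Qed.

Lemma expectZ p f c : expect p (fun t => c * f t) = c * expect p f.
Proof. by rewrite /expect mulr_sumr; apply: eq_bigr => t _; rewrite mulrCA. Qed.

Lemma expectN p f : expect p (fun t => - f t) = - expect p f.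
Proof. by rewrite /expect -sumrN; apply: eq_bigr => t _; rewrite mulrN. Qed.

Lemma expectB p f g : expect p (fun t => f t - g t) = expect p f - expect p g.
Proof. by rewrite expectD expectN. Qed.

Lemma expect_cst p c : is_dist p -> expect p (fun=> c) = c.
Proof. by case=> _ p1; rewrite /expect -mulr_suml p1 mul1r. Qed.

Lemma expect_le p f g : (forall t, 0 <= p t) -> (forall t, f t <= g t) ->
  expect p f <= expect p g.
Proof. by move=> p0 fg; apply: ler_sum => t _; apply: ler_wpM2l. Qed.

Lemma expect_ge0 p f : (forall t, 0 <= p t) -> (forall t, 0 <= f t) ->
  0 <= expect p f.
Proof. by move=> p0 f0; apply: sumr_ge0 => t _; apply: mulr_ge0. Qed.

Lemma expect_le_cst p f c : is_dist p -> (forall t, f t <= c) -> expect p f <= c.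
Proof. by move=> dp fc; rewrite -[leRHS](expect_cst c dp); apply: expect_le => //; case: dp. Qed.

Lemma expect_ge_cst p f c : is_dist p -> (forall t, c <= f t) -> c <= expect p f.
Proof. by move=> dp fc; rewrite -[leLHS](expect_cst c dp); apply: expect_le => //; case: dp. Qed.

Lemma expect_sqr_sub p f c : is_dist p ->
  expect p (fun t => (f t - c) ^+ 2) =
  expect p (fun t => f t ^+ 2) - 2 * c * expect p f + c ^+ 2.
Proof.
move=> dp; rewrite -(expect_cst (c ^+ 2) dp) -expectZ -expectB -expectD.
by apply: eq_expect => t; ring.
Qed.

Lemma variance_le p f c : is_dist p ->
  expect p (fun t => (f t - expect p f) ^+ 2) <= expect p (fun t => (f t - c) ^+ 2).
Proof.
by move=> dp; rewrite !expect_sqr_sub//; have := sqr_ge0 (expect p f - c); nra.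
Qed.

(** Since [1 - x <= expR (- x)], it is enough that the quadratic times [1 - x], which is
    [1 + x ^+ 2 * (1 - 2 * x)], is at least 1. *)
Lemma expR_le_quad (x : R) : x <= 1 / 2 -> expR x <= 1 + x + 2 * x ^+ 2.
Proof.
move=> x2; have h : 0 < 1 - x by lra.
rewrite -[x in expR x]opprK expRN -div1r ler_pdivrMr ?expR_gt0//.
have h1 := @expR_ge1Dx R (- x).
have h2 : 1 <= (1 + x + 2 * x ^+ 2) * (1 - x).
  have : 0 <= x ^+ 2 * (1 - 2 * x) by rewrite mulr_ge0 ?sqr_ge0//; lra.
  by rewrite !expr2; lra.
apply: (le_trans h2); apply: ler_wpM2l; last by lra.
(* The quadratic is nonnegative: it equals [2 * (x + 1 / 4) ^+ 2 + 7 / 8]. *)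
by have := sqr_ge0 (x + 1 / 4); rewrite !expr2; lra.
Qed.

(** The linear term of [expR_le_quad] has mean zero, and [1 + y <= expR y] turns what remains into
    an exponential, ready to be raised to the power [n]. *)
Lemma mgf_le p f (eta : R) : is_dist p ->
  (forall t, eta * (f t - expect p f) <= 1 / 2) ->
  expect p (fun t => expR (eta * (f t - expect p f))) <=
  expR (2 * eta ^+ 2 * expect p (fun t => (f t - expect p f) ^+ 2)).
Proof.
move=> dp fb; set m := expect p f.
apply: (@le_trans _ _ (1 + 2 * eta ^+ 2 * expect p (fun t => (f t - m) ^+ 2))); last first.
  exact: expR_ge1Dx.
have e0 : expect p (fun t => eta * (f t - m)) = 0.
  by rewrite expectZ expectB expect_cst// subrr mulr0.
rewrite -[X in X + _](expect_cst 1 dp) -[X in X + _]addr0 -{1}e0 -expectZ -!expectD.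
apply: expect_le; first by case: dp.
by move=> t; apply: (le_trans (expR_le_quad (fb t))); rewrite exprMn -/m; lra.
Qed.

Lemma sum_prod_ffun (n : nat) (F : T -> R) :
  \sum_(y : {ffun 'I_n -> T}) \prod_i F (y i) = (\sum_t F t) ^+ n.
Proof.
by rewrite -(bigA_distr_bigA (fun=> F)) prodr_const card_ord.
Qed.

(** Chernoff's method with [eta] given instead of optimised: the threshold is then linear in the
    variance, the form that telescopes along a Bellman recursion. *)
Lemma bernstein_tail p f (eta L : R) (n : nat) : (0 < n)%N -> is_dist p -> 0 < eta ->
  (forall t, eta * (f t - expect p f) <= 1 / 2) ->
  \sum_(y : {ffun 'I_n -> T} | 2 * eta * expect p (fun t => (f t - expect p f) ^+ 2)
       + L / (eta * n%:R) < n%:R^-1 * \sum_i f (y i) - expect p f) \prod_i p (y i)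
  <= expR (- L).
Proof.
move=> n0 dp eta0 fb; set m := expect p f; set V := expect p (fun t => (f t - m) ^+ 2).
have p0 t : 0 <= p t by case: dp.
have nR : 0 < n%:R :> R by rewrite ltr0n.
(* The inserted factor is the exponential of [eta * n%:R] times the excess over the threshold: at
   least 1 on deviating samples, nonnegative elsewhere. *)
apply: (@le_trans _ _ (\sum_(y : {ffun 'I_n -> T})
   expR (- L - n%:R * (2 * eta ^+ 2 * V)) * \prod_i (p (y i) * expR (eta * (f (y i) - m))))).
  rewrite big_mkcond; apply: ler_sum => y _.
  have pp : 0 <= \prod_i p (y i) by apply: prodr_ge0.
  case: ifPn => [dev|_]; last first.
    by rewrite mulr_ge0 ?expR_ge0// prodr_ge0// => i _; rewrite mulr_ge0 ?expR_ge0.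
  rewrite big_split /= -expR_sum mulrCA -expRD ler_peMr// -[leLHS]expR0 ler_expR.
  rewrite -mulr_sumr sumrB sumr_const card_ord -[m *+ n]mulr_natl.
  set Sf := \sum_i _ in dev *.
  have -> : - L - n%:R * (2 * eta ^+ 2 * V) + eta * (Sf - n%:R * m) =
     (eta * n%:R) * (n%:R^-1 * Sf - m - (2 * eta * V + L / (eta * n%:R))).
    by field; rewrite !gt_eqF.
  by rewrite mulr_ge0 ?subr_ge0 ?(ltW dev)// mulr_ge0// ltW.
rewrite -mulr_sumr (sum_prod_ffun n (fun t => p t * expR (eta * (f t - m)))) expRD.
rewrite -[leRHS]mulr1 -mulrA ler_wpM2l ?expR_ge0//.
have := mgf_le dp fb; rewrite -/m -/V => hm.
rewrite mulrC expRN ler_pdivrMr ?expR_gt0// mul1r expRM_natl.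
by apply: lerXn2r; rewrite ?nnegrE ?expR_ge0//; apply: sumr_ge0 => t _; rewrite mulr_ge0 ?expR_ge0.
Qed.
End Expectation.

(** * Maximum principle, Bellman equations and optimal values *)

Section Bellman.
Variables (R : realType) (S A : nat) (g : R).
Hypothesis g01 : 0 < g < 1.
Implicit Types (k : 'I_S -> 'I_A -> 'I_S -> R) (r pi : 'I_S -> 'I_A -> R).
Implicit Types (u v w : 'I_S -> R).

(** Missing mass means termination with value 0; freezing a pair produces a row of mass 0. *)
Definition is_subkernel k :=
  (forall s a t, 0 <= k s a t) /\ forall s a, \sum_t k s a t <= 1.

Lemma subkernel_of_kernel k : is_kernel k -> is_subkernel k.
Proof. by case=> k0 k1; split=> // s a; rewrite k1. Qed.

Lemma argmaxP v (s0 : 'I_S) : exists s, forall t, v t <= v s.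
Proof. by exists [arg max_(s > s0) v s]%O; case: arg_maxP => // s _ sm t; apply: sm. Qed.

Lemma expect_subkernel_le k s a v c : is_subkernel k -> 0 <= c ->
  (forall t, v t <= c) -> expect (k s a) v <= c.
Proof.
move=> [k0 k1] c0 vc; apply: (@le_trans _ _ (\sum_t k s a t * c)).
  by apply: ler_sum => t _; rewrite ler_wpM2l.
by rewrite -mulr_suml ler_piMl.
Qed.

(** At a maximiser [u s <= c + g * u s]. The hypothesis concerns positive global maximisers only:
    positivity serves the rows of mass below 1, and maximality is what later excludes active
    clipping. *)
Lemma max_principle u c : 0 <= c ->
  (forall s, (forall t, u t <= u s) -> 0 < u s ->
    exists2 m, m <= u s & u s <= c + g * m) ->
  forall s, u s <= c * (1 - g)^-1.
Proof.
move=> c0 h s; have [z zm] := argmaxP u s; apply: (le_trans (zm s)).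
have g1 : 0 < 1 - g by rewrite subr_gt0; case/andP: g01.
have [uz|uz] := leP (u z) 0; first by apply: (le_trans uz); rewrite mulr_ge0// invr_ge0 ltW.
have [m mu um] := h z zm uz.
have/andP[/ltW g0 _] := g01; have := ler_wpM2l g0 mu.
by rewrite ler_pdivlMr// => gm; lra.
Qed.

Definition subsolution k r v :=
  forall s, exists a, v s <= r s a + g * expect (k s a) v.

Lemma subsolution_le_super k r v w : is_subkernel k -> subsolution k r v ->
  (forall s a, r s a + g * expect (k s a) w <= w s) -> forall s, v s <= w s.
Proof.
move=> hk sv sw s; rewrite -subr_le0.
suff : v s - w s <= 0 * (1 - g)^-1 by rewrite mul0r.
apply: (@max_principle (fun s => v s - w s) 0) => // {}s sm s0.
have [a va] := sv s; exists (expect (k s a) (fun t => v t - w t)).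
  by apply: expect_subkernel_le => //; exact: ltW.
by rewrite expectB; have := sw s a; lra.
Qed.

Lemma subsolution_le k r v B : is_subkernel k -> 0 <= B ->
  (forall s a, r s a <= B) -> subsolution k r v -> forall s, v s <= B * (1 - g)^-1.
Proof.
move=> hk B0 rB sv; apply: max_principle => // s sm s0.
have [a va] := sv s; exists (expect (k s a) v).
  by apply: expect_subkernel_le => //; exact: ltW.
by have := rB s a; lra.
Qed.

(** Perron's construction: a supremum of subsolutions, which involves no policies and makes sense
    for subkernels. *)
Definition opt k r (s : 'I_S) : R := sup [set v s | v in subsolution k r].

Section Opt.
Variables (k : 'I_S -> 'I_A -> 'I_S -> R) (r : 'I_S -> 'I_A -> R) (B : R).
Hypotheses (hk : is_subkernel k) (A0 : (0 < A)%N) (r0 : forall s a, 0 <= r s a)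
  (B0 : 0 <= B) (rB : forall s a, r s a <= B).

Lemma opt_has_sup s : has_sup [set v s | v in subsolution k r].
Proof.
split; last by exists (B * (1 - g)^-1) => _ [v sv <-]; apply: (subsolution_le hk).
exists 0, (fun=> 0) => // t; exists (Ordinal A0).
rewrite addr_ge0// mulr_ge0//; first by case/andP: g01 => /ltW.
by apply: expect_ge0 => //; case: hk.
Qed.

Lemma opt_ge v : subsolution k r v -> forall s, v s <= opt k r s.
Proof. by move=> sv s; apply: (sup_upper_bound (opt_has_sup s)); exists v. Qed.

Lemma opt_ge0 s : 0 <= opt k r s.
Proof.
apply: (@opt_ge (fun=> 0)) => // t; exists (Ordinal A0).
rewrite addr_ge0// mulr_ge0//; first by case/andP: g01 => /ltW.
by apply: expect_ge0 => //; case: hk.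
Qed.

Lemma opt_le w : (forall s a, r s a + g * expect (k s a) w <= w s) ->
  forall s, opt k r s <= w s.
Proof.
move=> sw s; apply: ge_sup; first by case: (opt_has_sup s).
by move=> _ [v sv <-]; exact: (subsolution_le_super hk sv sw).
Qed.

Lemma bellman_argmax v : exists pi : 'I_S -> 'I_A, forall s a,
  r s a + g * expect (k s a) v <= r s (pi s) + g * expect (k s (pi s)) v.
Proof.
exists (fun s => [arg max_(a > Ordinal A0) (r s a + g * expect (k s a) v)]%O) => s a.
by case: arg_maxP => // b _ bm; apply: bm.
Qed.

(** The greedy update [w] of the supremum dominates every subsolution, hence the supremum; by
    monotonicity of the update it is then itself a subsolution, so the two agree. *)
Lemma opt_bellman : exists pi : 'I_S -> 'I_A,
  (forall s, opt k r s = r s (pi s) + g * expect (k s (pi s)) (opt k r)) /\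
  (forall s a, r s a + g * expect (k s a) (opt k r) <= opt k r s).
Proof.
have [pi pim] := bellman_argmax (opt k r); exists pi.
have g0 : 0 <= g by case/andP: g01 => /ltW.
have [k0 _] := hk.
set w := fun s => r s (pi s) + g * expect (k s (pi s)) (opt k r).
have le1 s : opt k r s <= w s.
  apply: ge_sup; first by case: (opt_has_sup s).
  move=> _ [v sv <-]; have [a va] := sv s; apply: (le_trans va); apply: le_trans (pim s a).
  by rewrite lerD2l ler_wpM2l//; apply: expect_le => // t; exact: opt_ge.
have le2 s : w s <= opt k r s.
  apply: opt_ge => t; exists (pi t); rewrite /w lerD2l ler_wpM2l//.
  by apply: expect_le.
have e s : opt k r s = w s by apply/eqP; rewrite eq_le le1 le2.
by split=> // s a; rewrite e; exact: pim.
Qed.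

End Opt.

Definition vfun k r pi : 'I_S -> R := fun s => value k r g pi s ord0.

Definition avg pi (f : 'I_S -> 'I_A -> R) s := expect (pi s) (f s).

Lemma avg_bellman k r pi v s :
  avg pi (fun s a => r s a + g * expect (k s a) v) s =
  \sum_a pi s a * r s a + g * \sum_t (\sum_a pi s a * k s a t) * v t.
Proof.
rewrite /avg expectD expectZ; congr (_ + _ * _).
under [RHS]eq_bigr do rewrite mulr_suml.
rewrite exchange_big /=; apply: eq_bigr => a _; rewrite /expect mulr_sumr.
by apply: eq_bigr => t _; rewrite mulrA.
Qed.

Lemma is_dist_policy pi s : is_policy pi -> is_dist (pi s).
Proof. by case=> p0 p1; split. Qed.

Lemma policy_super_unique k r pi v w : is_subkernel k -> is_policy pi ->
  (forall s, v s <= avg pi (fun s a => r s a + g * expect (k s a) v) s) ->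
  (forall s, avg pi (fun s a => r s a + g * expect (k s a) w) s <= w s) ->
  forall s, v s <= w s.
Proof.
move=> hk hpi sv sw s; rewrite -subr_le0.
suff : v s - w s <= 0 * (1 - g)^-1 by rewrite mul0r.
apply: (@max_principle (fun s => v s - w s) 0) => // {}s sm s0.
exists (avg pi (fun s a => expect (k s a) (fun t => v t - w t)) s).
  apply: expect_le_cst; first exact: is_dist_policy.
  by move=> a; apply: expect_subkernel_le => //; exact: ltW.
have -> : 0 + g * avg pi (fun s a => expect (k s a) (fun t => v t - w t)) s =
   avg pi (fun s a => r s a + g * expect (k s a) v) s -
   avg pi (fun s a => r s a + g * expect (k s a) w) s.
  rewrite add0r /avg -expectB -expectZ; apply: eq_expect => a; rewrite expectB; ring.
by have := sv s; have := sw s; lra.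
Qed.

(** A vector killed by the matrix solves the Bellman equation with zero reward; comparison with 0
    from both sides makes it vanish. The transpose is there because [kermx] is a left kernel. *)
Lemma bellman_unit k pi : is_subkernel k -> is_policy pi ->
  (1%:M - g *: Pmat k pi) \in unitmx.
Proof.
move=> hk hpi; rewrite -unitmx_tr -row_free_unit; apply/row_freeP.
set M := (_)^T; apply/row_freeP; rewrite -kermx_eq0; apply/eqP/row_matrixP => i.
rewrite row0; set x := row i _.
have : x *m M = 0 by apply/sub_kermxP; rewrite row_sub.
move=> /(congr1 trmx); rewrite trmx_mul trmxK trmx0 mulmxBl mul1mx -scalemxAl => /matrixP xE.
have e s : x 0 s = avg pi (fun s a => 0 + g * expect (k s a) (x 0)) s.
  rewrite avg_bellman big1 ?add0r; last by move=> a _; rewrite mulr0.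
  have := xE s 0; rewrite !mxE => /eqP; rewrite subr_eq0 => /eqP ->; congr (_ * _).
  by apply: eq_bigr => t _; rewrite !mxE.
have z s : 0 = avg pi (fun s a => 0 + g * expect (k s a) (fun=> 0)) s.
  rewrite /avg /expect big1 // => a _; rewrite big1 ?mulr0 ?addr0 ?mulr0// => t _.
  by rewrite mulr0.
apply/rowP => s; rewrite [RHS]mxE; apply/eqP; rewrite eq_le; apply/andP; split.
  apply: (policy_super_unique (r := fun _ _ => 0) (v := x 0) (w := fun=> 0) hk hpi) => t.
    by rewrite -e.
  by rewrite -z.
apply: (policy_super_unique (r := fun _ _ => 0) (v := fun=> 0) (w := x 0) hk hpi) => t.
  by rewrite -z.
by rewrite -e.
Qed.

Lemma vfunE k r pi s : is_subkernel k -> is_policy pi ->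
  vfun k r pi s = avg pi (fun s a => r s a + g * expect (k s a) (vfun k r pi)) s.
Proof.
move=> hk hpi; rewrite avg_bellman.
have : (1%:M - g *: Pmat k pi) *m value k r g pi = rvec r pi.
  by rewrite mulKVmx// bellman_unit.
rewrite /vfun; move: (value k r g pi) => u.
rewrite mulmxBl mul1mx -scalemxAl => /matrixP/(_ s 0); rewrite !mxE => <-.
rewrite -[LHS](subrK (g * \sum_t (\sum_a pi s a * k s a t) * u t 0)); congr (_ - _ * _ + _).
by apply: eq_bigr => t _; rewrite !mxE.
Qed.

End Bellman.

(** * Comparison of values in two models, given a variance-dependent deviation bound *)

Lemma is_dist_kernel (R : realType) (S A : nat) (k : 'I_S -> 'I_A -> 'I_S -> R) s a :
  is_kernel k -> is_dist (k s a).
Proof. by case=> k0 k1; split. Qed.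

(* The quadratic term [8 * eta * (V - m)^2] makes the Bernstein variance
   telescope along the Bellman recursion. *)
Lemma value_le_empirical_value (R : realType) (S A : nat) (g : R) (k kh : 'I_S -> 'I_A -> 'I_S -> R)
    (r : 'I_S -> 'I_A -> R) (K eta e : R)
    (pi : 'I_S -> 'I_A) (V U : 'I_S -> R) (m : R) :
  0 < g < 1 -> is_kernel k -> is_kernel kh -> (forall s a, 0 <= r s a <= 1) ->
  1 <= K -> (1 - g) * K <= 2 -> 0 < eta -> eta * K <= 16^-1 -> 0 <= e -> e <= 1 ->
  let F := fun s => V s + 8 * eta * (V s - m) ^+ 2 in
  0 <= m -> (forall s, m <= V s <= m + K) ->
  (forall s, V s <= r s (pi s) + g * expect (k s (pi s)) V) ->
  (forall s, r s (pi s) + g * expect (kh s (pi s)) U <= U s) ->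
  (forall s a, expect (k s a) F - expect (kh s a) F <=
     2 * eta * expect (k s a) (fun t => (F t - F s) ^+ 2) + e) ->
  forall s, V s <= U s + (32 * (eta * K) + e) * (1 - g)^-1.
Proof.
move=> g01 hk hkh r01 K1 gK eta0 etaK e0 e1.
have dk s a := is_dist_kernel s a hk; have dkh s a := is_dist_kernel s a hkh.
have g0 : 0 <= g by case/andP: g01 => /ltW.
have g1 : g <= 1 by case/andP: g01 => _ /ltW.
move=> F m0 mV sV sU conc.
suff h s : F s - U s <= (32 * (eta * K) + e) * (1 - g)^-1.
  move=> s; have := h s; rewrite /F.
  have : 0 <= 8 * eta * (V s - m) ^+ 2 by rewrite mulr_ge0 ?sqr_ge0// mulr_ge0 ?(ltW eta0).
  by lra.
have eK : 0 <= eta * K by rewrite mulr_ge0 ?(ltW eta0) ?(le_trans _ K1).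
apply: (max_principle g01 (u := fun s => F s - U s)); first by lra.
move=> {}s smax _; set p := k s (pi s); set q := kh s (pi s).
exists (expect q (fun t => F t - U t)).
  by apply: (expect_le_cst (dkh s (pi s))).
set t := V s - m; set P1 := expect p (fun y => V y - m).
set P2 := expect p (fun y => (V y - m) ^+ 2).
have [t0 tK] : 0 <= t /\ t <= K by have := mV s; rewrite /t; lra.
have P1E : P1 = expect p V - m by rewrite /P1 expectB expect_cst//; exact: dk.
have PFE : expect p F = expect p V + 8 * eta * P2 by rewrite expectD expectZ.
have P10 : 0 <= P1 by apply: expect_ge0 => [y|y]; [case: (dk s (pi s)) | rewrite subr_ge0; have/andP[] := mV y].
(* One Bellman step raises the centred value by at most the reward, because [(1 - g) * m] and
   [(1 - g) * P1] are nonnegative. *)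
have tP : t <= 1 + P1.
  have := sV s; rewrite -/p => Vs; have /andP[_ r1] := r01 s (pi s).
  have : 0 <= (1 - g) * m by rewrite mulr_ge0 // subr_ge0.
  have : 0 <= (1 - g) * P1 by rewrite mulr_ge0 // subr_ge0.
  by rewrite /t; rewrite P1E in P10 *; lra.
(* As [16 * (eta * K) <= 1], the tilt is 2-Lipschitz in [V], whence the factor 4. Then
   [P2 - 2 * t * P1 + t ^+ 2] is bounded through [P1 >= t - 1]. *)
have varF : expect p (fun y => (F y - F s) ^+ 2) <= 4 * (P2 - t ^+ 2 + 2 * t).
  apply: (@le_trans _ _ (expect p (fun y => 4 * ((V y - m) - t) ^+ 2))).
    apply: expect_le => [y|y]; first by case: (dk s (pi s)).
    have [x0 xK] : 0 <= V y - m /\ V y - m <= K by have := mV y; lra.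
    have -> : F y - F s = (V y - m - t) * (1 + 8 * eta * (V y - m + t)).
      by rewrite /F -/t /t; ring.
    rewrite exprMn mulrC ler_wpM2r ?sqr_ge0//.
    have : eta * (V y - m + t) <= eta * K + eta * K.
      by rewrite -mulrDr ler_wpM2l ?(ltW eta0)// lerD.
    have : 0 <= eta * (V y - m + t) by rewrite mulr_ge0 ?(ltW eta0)// addr_ge0.
    rewrite -mulrA; move: (eta * (_ + _)) => z z0 zK.
    have -> : 4 = 2 ^+ 2 :> R by ring.
    by apply: lerXn2r; rewrite ?nnegrE; lra.
  rewrite expectZ ler_wpM2l// expect_sqr_sub; last exact: dk.
  by rewrite -/P1 -/P2; have := mulr_ge0 t0 (_ : 0 <= P1 - t + 1); nra.
have cs := conc s (pi s); rewrite -/p -/q in cs.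
have cs2 : expect p F <= expect q F + 8 * eta * (P2 - t ^+ 2 + 2 * t) + e.
  by have := ler_wpM2l (ltW eta0) varF; lra.
(* Once [P2] has cancelled, [8 * eta * (1 - g) * t ^+ 2 + 16 * g * eta * t] is left over. Each term
   is at most [16 * (eta * K)], the first thanks to [(1 - g) * K <= 2]; together they give the
   32. *)
have t2 : (1 - g) * (eta * t ^+ 2) <= 2 * (eta * K).
  apply: (@le_trans _ _ ((1 - g) * (eta * (K * K)))).
    by rewrite ler_wpM2l ?subr_ge0// ler_wpM2l ?(ltW eta0)// expr2 ler_pM.
  have -> : (1 - g) * (eta * (K * K)) = ((1 - g) * K) * (eta * K) by ring.
  by rewrite ler_wpM2r.
have t1 : g * (eta * t) <= eta * K.
  apply: (@le_trans _ _ (1 * (eta * t))); first by rewrite ler_wpM2r// mulr_ge0 ?(ltW eta0).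
  by rewrite mul1r ler_wpM2l ?(ltW eta0).
have ge : g * e <= e by rewrite ler_piMl.
have := ler_wpM2l g0 cs2; have := sV s; have := sU s.
rewrite -/p -/q expectB /F -/t PFE.
by lra.
Qed.

(** The recursion now runs under [kh] while the variance is taken under [k], so the Bellman step
    bounds [t] by a quantity containing the variance term [y] itself. The resulting bound on [y] is
    self-referential and closes because [eta * t <= 16^-1]. The final disjunction says that the
    clipping is inactive or that [U] has span below [K]. *)
Lemma empirical_value_le_value (R : realType) (S A : nat) (g : R) (k kh : 'I_S -> 'I_A -> 'I_S -> R)
    (r : 'I_S -> 'I_A -> R) (K eta e : R)
    (pi : 'I_S -> 'I_A -> R) (v U : 'I_S -> R) (z : 'I_S) :
  0 < g < 1 -> is_kernel k -> is_kernel kh -> (forall s a, 0 <= r s a <= 1) ->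
  1 <= K -> (1 - g) * K <= 2 -> 0 < eta -> eta * K <= 16^-1 -> 0 <= e -> e <= 1 ->
  let b := v z - K in
  let f := fun s => Num.max (v s) b in
  is_policy pi -> 0 <= v z -> (forall s, v s <= v z) ->
  (forall s, v s <= avg pi (fun s a => r s a + g * expect (kh s a) v) s) ->
  (forall s, avg pi (fun s a => r s a + g * expect (k s a) U) s <= U s) ->
  (forall s a, expect (kh s a) f - expect (k s a) f <=
     2 * eta * expect (k s a) (fun t => (f t - f s) ^+ 2) + e) ->
  (forall s, b < v s) \/ (forall s t, U s - U t < K) ->
  forall s, v s <= U s + (40 * (eta * K) + e) * (1 - g)^-1.
Proof.
move=> g01 hk hkh r01 K1 gK eta0 etaK e0 e1.
have dk s a := is_dist_kernel s a hk; have dkh s a := is_dist_kernel s a hkh.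
have g0 : 0 <= g by case/andP: g01 => /ltW.
have g1 : g <= 1 by case/andP: g01 => _ /ltW.
move=> b f hpi vz0 vz sv sU conc span.
have eK : 0 <= eta * K by rewrite mulr_ge0 ?(ltW eta0) ?(le_trans _ K1).
pose F := fun s => f s + 4 * eta * (f s - b) ^+ 2.
have fge s : v s <= f s by rewrite le_max lexx.
have fb s : b <= f s by rewrite le_max lexx orbT.
have fK s : f s - b <= K by rewrite lerBlDr ge_max; have := vz s; rewrite /b; lra.
suff h s : F s - U s <= (40 * (eta * K) + e) * (1 - g)^-1.
  move=> s; have := h s; rewrite /F; have := fge s.
  have : 0 <= 4 * eta * (f s - b) ^+ 2 by rewrite mulr_ge0 ?sqr_ge0// mulr_ge0 ?(ltW eta0).
  by lra.
apply: (max_principle g01 (u := fun s => F s - U s)); first by lra.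
move=> {}s smax _.
(* Were the clipping active at [s], then [f s = b = v z - K], and maximality of [F - U] at [s]
   compared with [z] would force [U z - U s >= K]. *)
have vb : b < v s.
  case: span => // spU; rewrite ltNge; apply/negP => vb.
  have := smax z; rewrite /F /f (max_idPr vb) (@max_idPl _ _ (v z) b _) ?/b; last by lra.
  have := spU z s; have : 0 <= 4 * eta * (v z - (v z - K)) ^+ 2 by rewrite mulr_ge0 ?sqr_ge0// mulr_ge0 ?(ltW eta0).
  by rewrite subrr expr0n mulr0; lra.
have fE : f s = v s by rewrite /f (max_idPl (ltW vb)).
have dpi := is_dist_policy s hpi.
exists (avg pi (fun s a => expect (k s a) (fun t => F t - U t)) s).
  by apply: (expect_le_cst dpi) => a; apply: (expect_le_cst (dk s a)).
pose E (h : 'I_S -> R) := expect (pi s) (fun a => expect (k s a) h).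
pose ra := expect (pi s) (r s).
have ED h1 h2 : E (fun t => h1 t + h2 t) = E h1 + E h2.
  by rewrite /E -expectD; apply: eq_expect => a; rewrite expectD.
have EB h1 h2 : E (fun t => h1 t - h2 t) = E h1 - E h2.
  by rewrite /E -expectB; apply: eq_expect => a; rewrite expectB.
have EZ c h : E (fun t => c * h t) = c * E h.
  by rewrite /E -expectZ; apply: eq_expect => a; rewrite expectZ.
have EC c : E (fun=> c) = c.
  by rewrite /E -[RHS](expect_cst c dpi); apply: eq_expect => a; rewrite expect_cst//; exact: dk.
have E0 h : (forall t, 0 <= h t) -> 0 <= E h.
  move=> h0; apply: expect_ge0 => [a|a]; first by case: dpi.
  by apply: expect_ge0 => //; case: (dk s a).
have avgE h : avg pi (fun s a => r s a + g * expect (k s a) h) s = ra + g * E h.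
  by rewrite /avg expectD expectZ.
set t := f s - b; set P1 := E (fun y => f y - b); set P2 := E (fun y => (f y - b) ^+ 2).
have t0 : 0 <= t by rewrite subr_ge0.
have tK : t <= K := fK s.
pose y := 2 * eta * E (fun x => (f x - f s) ^+ 2).
have yE : y = 2 * eta * (P2 - 2 * t * P1 + t ^+ 2).
  congr (_ * _); rewrite -(EC (t ^+ 2)) -EZ -EB -ED.
  by apply: eq_expect => a; apply: eq_expect => x; rewrite /t; ring.
have P1E : P1 = E f - b by rewrite /P1 EB EC.
have P10 : 0 <= P1 by apply: E0 => x; rewrite subr_ge0.
have y0 : 0 <= y by rewrite !mulr_ge0 ?(ltW eta0)// E0// => x; exact: sqr_ge0.
have ra1 : ra <= 1 by apply: expect_le_cst => // a; have/andP[] := r01 s a.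
have vs : v s <= ra + g * (E f + y + e).
  apply: (le_trans (sv s)); rewrite /avg expectD expectZ lerD2l ler_wpM2l//.
  rewrite /y -(expect_cst e dpi) /E -!expectZ -!expectD.
  apply: expect_le => [a|a]; first by case: dpi.
  apply: (@le_trans _ _ (expect (kh s a) f)).
    by apply: expect_le => //; case: (dkh s a).
  by have := conc s a; lra.
have gP1 : g * P1 <= P1 by rewrite ler_piMl.
have gy : g * y <= y by rewrite ler_piMl.
have ge : g * e <= e by rewrite ler_piMl.
(* The 4 collects 1 from the reward, 1 from [e] and 2 from [(1 - g) * K], the last because the
   centre [b] may be negative. *)
have tP : t <= P1 + y + 4.
  have : 0 <= (1 - g) * v z by rewrite mulr_ge0// subr_ge0.
  have bE : b = v z - K by [].
  move: vs gP1; rewrite P1E /t fE bE; clear -ra1 gK gy ge e1; lra.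
have ety : eta * t * y <= 16^-1 * y.
  by rewrite ler_wpM2r//; apply: le_trans etaK; rewrite ler_wpM2l ?(ltW eta0).
have etK : eta * t <= eta * K by rewrite ler_wpM2l ?(ltW eta0).
(* Inserting [tP] into [yE] leaves [4 * eta * t * y <= y / 4] on the right, which is absorbed on the
   left. *)
have yle : y <= 4 * eta * (P2 - t ^+ 2) + 32 * (eta * K).
  have et : 0 <= eta * t by rewrite mulr_ge0 ?(ltW eta0).
  have := ler_wpM2l et tP; move: yE ety etK y0; clearbody y; clear; lra.
have t2 : (1 - g) * (eta * t ^+ 2) <= 2 * (eta * K).
  apply: (@le_trans _ _ ((1 - g) * (eta * (K * K)))).
    by rewrite ler_wpM2l ?subr_ge0// ler_wpM2l ?(ltW eta0)// expr2 ler_pM.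
  have -> : (1 - g) * (eta * (K * K)) = ((1 - g) * K) * (eta * K) by ring.
  by rewrite ler_wpM2r.
have geK : g * (eta * K) <= eta * K by rewrite ler_piMl.
have := sU s; rewrite avgE.
have -> : avg pi (fun s a => expect (k s a) (fun t => F t - U t)) s = E f + 4 * eta * P2 - E U.
  by rewrite -EZ -ED -EB.
rewrite /F -/t fE; have := ler_wpM2l g0 yle; clear -vs t2 ge geK.
by lra.
Qed.


(** * Product weights: resampling one coordinate, and the union bound *)

Section Resampling.
Variables (R : realType) (I Y : finType) (w : I -> Y -> R).
Hypotheses (w0 : forall p y, 0 <= w p y) (w1 : forall p, \sum_y w p y = 1).
Implicit Types (x : {ffun I -> Y}) (p : I).

Definition update x p y : {ffun I -> Y} := [ffun q => if q == p then y else x q].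

Lemma sum_prod_weight : \sum_(x : {ffun I -> Y}) \prod_q w q (x q) = 1.
Proof. by rewrite -bigA_distr_bigA big1. Qed.

(* The pair [(x, y)] has the same law as [(update x p y, x p)]. *)
Lemma resample p (h : {ffun I -> Y} -> R) :
  \sum_(x : {ffun I -> Y}) (\prod_q w q (x q)) * h x =
  \sum_(x : {ffun I -> Y}) (\prod_q w q (x q)) * \sum_y w p y * h (update x p y).
Proof.
pose swap (z : {ffun I -> Y} * Y) := (update z.1 p z.2, z.1 p).
have swapK : involutive swap.
  case=> x y; rewrite /swap /=; congr (_, _); last by rewrite ffunE eqxx.
  by apply/ffunP => q; rewrite !ffunE; case: eqP => // ->.
transitivity (\sum_(x : {ffun I -> Y}) \sum_y (\prod_q w q (x q)) * w p y * h x).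
  by apply: eq_bigr => x _; rewrite -mulr_suml -mulr_sumr w1 mulr1.
transitivity (\sum_(x : {ffun I -> Y}) \sum_y (\prod_q w q (x q)) * w p y * h (update x p y)); last first.
  by apply: eq_bigr => x _; rewrite mulr_sumr; apply: eq_bigr => y _; rewrite mulrA.
rewrite !pair_big /= (reindex_inj (inv_inj swapK)) /=.
apply: eq_bigr => -[x y] _ /=; congr (_ * _).
rewrite (bigD1 p)//= [in RHS](bigD1 p)//= ffunE eqxx.
rewrite [X in _ * X * _ = _](_ : _ = \prod_(q | q != p) w q (x q)); first by ring.
by apply: eq_bigr => q /negbTE qp; rewrite ffunE qp.
Qed.

(** The event [bad x] ignores the coordinate [p] of [x], so a fresh draw at [p] is independent of it
    and the bound holds conditionally on the other coordinates. *)
Lemma resample_le p (bad : {ffun I -> Y} -> pred Y) (c : R) :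
  (forall x y, bad (update x p y) =1 bad x) ->
  (forall x, \sum_(y | bad x y) w p y <= c) ->
  \sum_(x : {ffun I -> Y} | bad x (x p)) \prod_q w q (x q) <= c.
Proof.
move=> badE hc; rewrite big_mkcond /=.
rewrite (eq_bigr (fun x => (\prod_q w q (x q)) * (bad x (x p))%:R)); last first.
  by move=> x _; case: ifP; rewrite ?mulr1 ?mulr0.
rewrite (resample p (fun x => (bad x (x p))%:R)).
rewrite -[leRHS]mul1r -[X in X * c]sum_prod_weight mulr_suml; apply: ler_sum => x _.
apply: ler_wpM2l; first exact: prodr_ge0.
apply: le_trans (hc x); rewrite [leRHS]big_mkcond /=; apply: ler_sum => y _.
by rewrite badE ffunE eqxx; case: ifP; rewrite ?mulr1 ?mulr0.
Qed.

End Resampling.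

Lemma union_bound (R : realType) (T J : finType) (w : T -> R) (good : pred T)
    (bad : J -> pred T) (c : R) :
  (forall x, 0 <= w x) -> (forall x, ~~ good x -> exists j, bad j x) ->
  (forall j, \sum_(x | bad j x) w x <= c) ->
  \sum_(x | ~~ good x) w x <= #|J|%:R * c.
Proof.
move=> w0 gb hc; apply: (@le_trans _ _ (\sum_j \sum_(x | bad j x) w x)).
  rewrite (eq_bigr (fun j => \sum_x if bad j x then w x else 0)); last first.
    by move=> j _; rewrite big_mkcond.
  rewrite exchange_big big_mkcond /=; apply: ler_sum => x _.
  have pos j : 0 <= (if bad j x then w x else 0) by case: ifP.
  case: ifPn => [/gb[j bj]|_]; last exact: sumr_ge0.
  by rewrite (bigD1 j)//= bj lerDl sumr_ge0.
apply: (@le_trans _ _ (\sum_(j : J) c)); first by apply: ler_sum.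
by rewrite sumr_const mulr_natl.
Qed.

(** * The law of the sample table and deviations of empirical means *)

Section Samples.
Variables (R : realType) (S A n : nat).
Hypothesis n0 : (0 < n)%N.

Definition sample := {ffun 'I_S * 'I_A -> {ffun 'I_n -> 'I_S}}.

Definition emp (x : sample) : 'I_S -> 'I_A -> 'I_S -> R :=
  empirical R (fun s a i => x (s, a) i).

Lemma expect_empirical (X : 'I_S -> 'I_A -> 'I_n -> 'I_S) s a f :
  expect (empirical R X s a) f = n%:R^-1 * \sum_i f (X s a i).
Proof.
rewrite (partition_big (X s a) xpredT)//= mulr_sumr; apply: eq_bigr => t _.
rewrite (eq_bigr (fun=> f t)); last by move=> i /eqP ->.
rewrite sumr_const -[f t *+ _]mulr_natl /empirical mulrA [n%:R^-1 * _]mulrC.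
congr (_%:R / _ * _); apply: eq_card => i.
by apply/idP/idP; rewrite !inE.
Qed.

Lemma empirical_kernel (X : 'I_S -> 'I_A -> 'I_n -> 'I_S) : is_kernel (empirical R X).
Proof.
split=> [s a t|s a]; first by rewrite /empirical divr_ge0.
rewrite (eq_bigr (fun t => empirical R X s a t * 1)); last by move=> t _; rewrite mulr1.
rewrite -/(expect (empirical R X s a) (fun=> 1)) expect_empirical sumr_const card_ord mulVf//.
by rewrite pnatr_eq0 -lt0n.
Qed.

Variable k : 'I_S -> 'I_A -> 'I_S -> R.
Hypothesis hk : is_kernel k.

Definition weight (x : sample) : R := \prod_p \prod_i k p.1 p.2 (x p i).

Lemma weight_ge0 x : 0 <= weight x.
Proof. by apply: prodr_ge0 => p _; apply: prodr_ge0 => i _; case: hk. Qed.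

Lemma sum_weight_row (p : 'I_S * 'I_A) :
  \sum_(y : {ffun 'I_n -> 'I_S}) \prod_i k p.1 p.2 (y i) = 1.
Proof. by rewrite sum_prod_ffun; case: hk => _ ->; rewrite expr1n. Qed.

Lemma sum_weight : \sum_x weight x = 1.
Proof.
exact: (@sum_prod_weight R _ _ (fun (p : 'I_S * 'I_A) (y : {ffun 'I_n -> 'I_S}) =>
  \prod_i k p.1 p.2 (y i)) sum_weight_row).
Qed.

(** Only upper deviations are recorded; lower ones are obtained by passing the negated function. *)
Definition deviates (eta L : R) s a (f : 'I_S -> R) (x : sample) :=
  2 * eta * expect (k s a) (fun t => (f t - expect (k s a) f) ^+ 2)
    + L / (eta * n%:R) < expect (emp x s a) f - expect (k s a) f.

(** The test function may depend on the sample, but not on the row [(s, a)]: conditionally on the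
    other rows it is fixed and [bernstein_tail] applies. *)
Lemma deviates_le (eta L : R) s a (h : sample -> 'I_S -> R) :
  0 < eta -> (forall x y, h (update x (s, a) y) = h x) ->
  (forall x t u, eta * (h x t - h x u) <= 1 / 2) ->
  \sum_(x | deviates eta L s a (h x) x) weight x <= expR (- L).
Proof.
move=> eta0 hE hr.
have dk := is_dist_kernel s a hk.
pose w (p : 'I_S * 'I_A) (y : {ffun 'I_n -> 'I_S}) : R := \prod_i k p.1 p.2 (y i).
pose bad (x : sample) (y : {ffun 'I_n -> 'I_S}) :=
  2 * eta * expect (k s a) (fun t => (h x t - expect (k s a) (h x)) ^+ 2)
    + L / (eta * n%:R) < n%:R^-1 * \sum_i h x (y i) - expect (k s a) (h x).
have -> : \sum_(x | deviates eta L s a (h x) x) weight x =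
    \sum_(x | bad x (x (s, a))) \prod_p w p (x p).
  by apply: eq_bigl => x; rewrite /deviates expect_empirical.
apply: resample_le.
- by move=> p y; apply: prodr_ge0 => i _; case: hk.
- by move=> p; exact: sum_weight_row.
- by move=> x y z; rewrite /bad hE.
- move=> x; apply: (bernstein_tail L n0 dk eta0) => t.
  have -> : h x t - expect (k s a) (h x) = expect (k s a) (fun u => h x t - h x u).
    by rewrite expectB expect_cst.
  by rewrite -expectZ; apply: expect_le_cst.
Qed.

End Samples.

(** * Freezing a pair, clipping, and transfer of deviation bounds *)

Section Freezing.
Variables (R : realType) (S A : nat).
Implicit Types (k : 'I_S -> 'I_A -> 'I_S -> R) (r : 'I_S -> 'I_A -> R).

(* The pair [(s0, a0)] is made terminal with payoff [q], so the resulting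
   optimal value does not depend on the row [k s0 a0]. *)
Definition freeze_kernel k s0 a0 : 'I_S -> 'I_A -> 'I_S -> R :=
  fun s a t => if (s, a) == (s0, a0) then 0 else k s a t.

Definition freeze_reward r s0 a0 (q : R) : 'I_S -> 'I_A -> R :=
  fun s a => if (s, a) == (s0, a0) then q else r s a.

Definition frozen_opt (g : R) k r s0 a0 q : 'I_S -> R :=
  opt g (freeze_kernel k s0 a0) (freeze_reward r s0 a0 q).

Lemma freeze_subkernel k s0 a0 : is_subkernel k -> is_subkernel (freeze_kernel k s0 a0).
Proof.
move=> [k0 k1]; split=> [s a t|s a]; rewrite /freeze_kernel; first by case: ifP.
by case: ((s, a) == (s0, a0)); rewrite // big1// ler01.
Qed.

Lemma freeze_kernel_eq k k' s0 a0 :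
  (forall s a, (s, a) != (s0, a0) -> k s a = k' s a) ->
  freeze_kernel k s0 a0 = freeze_kernel k' s0 a0.
Proof.
move=> kk; apply/funext => s; apply/funext => a; apply/funext => t.
by rewrite /freeze_kernel; case: eqP => // /eqP ?; rewrite kk.
Qed.

Lemma expect_freeze k s0 a0 s a v :
  expect (freeze_kernel k s0 a0 s a) v = if (s, a) == (s0, a0) then 0 else expect (k s a) v.
Proof.
rewrite /expect /freeze_kernel; case: ifP => // _.
by rewrite big1// => t _; rewrite mul0r.
Qed.

Lemma frozen_opt_ge0 (g : R) k r s0 a0 q : 0 < g < 1 -> is_subkernel k -> (0 < A)%N ->
  (forall s a, 0 <= r s a <= 1) -> 0 <= q -> forall s, 0 <= frozen_opt g k r s0 a0 q s.
Proof.
move=> g01 hk A0 r01 q0 s; apply: (@opt_ge0 _ _ _ g g01 _ _ (Num.max 1 q)) => //.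
- exact: freeze_subkernel.
- by move=> {}s a; rewrite /freeze_reward; case: ifP => // _; case/andP: (r01 s a).
- by rewrite le_max ler01.
- move=> {}s a; rewrite /freeze_reward le_max; case: ifP => _; first by rewrite lexx orbT.
  by case/andP: (r01 s a) => _ ->.
Qed.

Lemma avg_le_max (pi : 'I_S -> 'I_A -> R) (f : 'I_S -> 'I_A -> R) s :
  is_policy pi -> (0 < A)%N -> exists a, avg pi f s <= f s a.
Proof.
move=> hpi A0; have [a am] := argmaxP (f s) (Ordinal A0).
by exists a; apply: (expect_le_cst (is_dist_policy s hpi)).
Qed.

Lemma frozen_opt_close (g : R) k r pi s0 a0 (q c : R) v vt :
  0 < g < 1 -> is_kernel k -> (0 < A)%N -> (forall s a, 0 <= r s a <= 1) ->
  is_policy pi -> 0 <= q -> 0 <= c ->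
  (forall s, v s <= avg pi (fun s a => r s a + g * expect (k s a) v) s) ->
  (forall s a, r s a + g * expect (k s a) vt <= vt s) ->
  (forall s, v s <= vt s) -> (forall s, vt s <= v s + c) ->
  q <= r s0 a0 + g * expect (k s0 a0) v <= q + c ->
  forall s, `|v s - frozen_opt g k r s0 a0 q s| <= c.
Proof.
move=> g01 hk A0 r01 hpi q0 c0 sv svt vvt vtc /andP[qQ Qq] s.
have g0 : 0 <= g by case/andP: g01 => /ltW.
have g1 : g <= 1 by case/andP: g01 => _ /ltW.
have hs := freeze_subkernel s0 a0 (subkernel_of_kernel hk).
have fr0 t a : 0 <= freeze_reward r s0 a0 q t a.
  by rewrite /freeze_reward; case: ifP => // _; case/andP: (r01 t a).
have frB t a : freeze_reward r s0 a0 q t a <= Num.max 1 q.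
  rewrite /freeze_reward le_max; case: ifP => _; first by rewrite lexx orbT.
  by case/andP: (r01 t a) => _ ->.
have B0 : 0 <= Num.max 1 q by rewrite le_max ler01.
have lo : v s - c <= frozen_opt g k r s0 a0 q s.
  apply: (opt_ge g01 hs A0 fr0 B0 frB (v := fun t => v t - c)) => t.
  have [a va] := avg_le_max (fun s a => r s a + g * expect (k s a) v) t hpi A0.
  exists a; rewrite expect_freeze /freeze_reward; have := sv t.
  case: eqP => [[ts aa]|_]; first by subst t a; move: va Qq; lra.
  rewrite expectB expect_cst; last exact: is_dist_kernel.
  have : g * c <= c by rewrite ler_piMl.
  by lra.
have hi : frozen_opt g k r s0 a0 q s <= vt s.
  apply: (opt_le g01 hs A0 fr0 B0 frB) => t a.
  rewrite expect_freeze /freeze_reward; case: eqP => [[ts aa]|_] //; subst t a.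
  rewrite mulr0 addr0; apply: le_trans (svt s0 a0); apply: (le_trans qQ).
  by rewrite lerD2l ler_wpM2l//; apply: expect_le => //; case: hk.
have := vtc s; rewrite ler_norml; move: lo hi; lra.
Qed.

(** The base value 0 is harmless, since the clipped functions are nonnegative. *)
Definition vmax (u : 'I_S -> R) : R := \big[Num.max/0]_s u s.

Lemma vmax_ge u s : u s <= vmax u.
Proof. exact: le_bigmax. Qed.

Lemma vmax_le u c : 0 <= c -> (forall s, u s <= c) -> vmax u <= c.
Proof. by move=> c0 uc; apply: bigmax_le. Qed.

Lemma vmax_ge0 u : 0 <= vmax u.
Proof. exact: bigmax_ge_id. Qed.

Lemma vmax_attained u (s0 : 'I_S) : (forall s, 0 <= u s) -> exists z, vmax u = u z.
Proof.
move=> u0; have [z zm] := argmaxP u s0; exists z.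
by apply/eqP; rewrite eq_le vmax_ge vmax_le.
Qed.

Definition clip (K : R) (u : 'I_S -> R) s : R := Num.max (u s) (vmax u - K).

Lemma clip_range (K : R) u s t : 0 <= K -> clip K u s - clip K u t <= K.
Proof.
move=> K0; have : clip K u s <= vmax u by rewrite ge_max vmax_ge lerBlDr lerDl.
have : vmax u - K <= clip K u t by rewrite le_max lexx orbT.
by lra.
Qed.

Lemma vmax_close u v (c : R) : 0 <= c -> (forall s, 0 <= v s) ->
  (forall s, u s <= v s + c) -> vmax u <= vmax v + c.
Proof.
move=> c0 v0 uv; apply: vmax_le => [|s]; first by rewrite addr_ge0// vmax_ge0.
by apply: (le_trans (uv s)); rewrite lerD2r vmax_ge.
Qed.

Lemma clip_close (K : R) u v (c : R) s : 0 <= c -> (forall s, 0 <= u s) ->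
  (forall s, 0 <= v s) -> (forall s, `|u s - v s| <= c) ->
  `|clip K u s - clip K v s| <= c.
Proof.
move=> c0 u0 v0 uv.
have h1 t : u t <= v t + c by have := uv t; rewrite ler_norml; lra.
have h2 t : v t <= u t + c by have := uv t; rewrite ler_norml; lra.
have m1 := vmax_close c0 v0 h1; have m2 := vmax_close c0 u0 h2.
rewrite ler_norml lerBrDr lerBlDr; apply/andP; split.
  rewrite addrC lerBlDr ge_max; apply/andP; split.
    by apply: (le_trans (h2 s)); rewrite lerD2r le_max lexx.
  apply: (@le_trans _ _ (vmax u - K + c)); first by lra.
  by rewrite lerD2r le_max lexx orbT.
rewrite addrC ge_max; apply/andP; split.
  by apply: (le_trans (h1 s)); rewrite lerD2r le_max lexx.
apply: (@le_trans _ _ (vmax v - K + c)); first by lra.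
by rewrite lerD2r le_max lexx orbT.
Qed.

End Freezing.

(** Each of the two means costs [c]. Recentring the variance at [f s] only increases it, and passing
    from [h] to [f] costs [2 * eta * (2 * K * c + c ^+ 2)], less than [c] since
    [eta * K <= 16^-1]. *)
Lemma deviation_transfer (R : realType) (T : finType) (p q f h : T -> R)
    (K eta e c : R) (s : T) :
  is_dist p -> is_dist q -> 0 <= c -> c <= 1 -> 1 <= K -> 0 < eta -> eta * K <= 16^-1 ->
  (forall t, `|f t - h t| <= c) -> (forall t u, f t - f u <= K) ->
  expect q h - expect p h <= 2 * eta * expect p (fun t => (h t - expect p h) ^+ 2) + e ->
  expect q f - expect p f <= 2 * eta * expect p (fun t => (f t - f s) ^+ 2) + (e + 3 * c).
Proof.
move=> dp dq c0 c1 K1 eta0 etaK fh fK conc; have K0 : 0 <= K by rewrite (le_trans _ K1).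
have p0 : forall t, 0 <= p t by case: dp.
have q0 : forall t, 0 <= q t by case: dq.
have h1 : expect q f <= expect q h + c.
  rewrite -(expect_cst c dq) -expectD; apply: expect_le => // t.
  by have := fh t; rewrite ler_norml; lra.
have h2 : expect p h <= expect p f + c.
  rewrite -(expect_cst c dp) -expectD; apply: expect_le => // t.
  by have := fh t; rewrite ler_norml; lra.
have h3 : expect p (fun t => (h t - expect p h) ^+ 2) <=
    expect p (fun t => (f t - f s) ^+ 2) + (2 * K * c + c ^+ 2).
  apply: (le_trans (variance_le h (f s) dp)).
  rewrite -(expect_cst (2 * K * c + c ^+ 2) dp) -expectD; apply: expect_le => // t.
  have := fh t; rewrite ler_norml => /andP[a1 a2].
  have := fK t s; have := fK s t => b1 b2.
  pose x := f t - f s; pose y := h t - f t.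
  have -> : h t - f s = x + y by rewrite /x /y; ring.
  have xK : `|x| <= K by rewrite ler_norml /x; lra.
  have yc : `|y| <= c by rewrite ler_norml /y; lra.
  have xy : x * y <= K * c by apply: (le_trans (ler_norm _)); rewrite normrM ler_pM.
  have y2 : y ^+ 2 <= c ^+ 2 by rewrite -[y ^+ 2]real_normK ?num_real// lerXn2r ?nnegrE.
  by rewrite sqrrD -/x; lra.
have eK : eta * K * c <= 16^-1 * c by rewrite ler_wpM2r.
have ec : eta * c ^+ 2 <= 16^-1 * c.
  rewrite expr2 mulrA ler_wpM2r// (le_trans _ etaK)// ler_wpM2l ?(ltW eta0)//.
  exact: le_trans K1.
have := ler_wpM2l (ltW eta0) h3; lra.
Qed.

(** * From the probability space to the finite sample table *)

Local Open Scope classical_set_scope.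

Definition to_sample (S A n : nat) (X : 'I_S -> 'I_A -> 'I_n -> 'I_S) : sample S A n :=
  [ffun p => [ffun i => X p.1 p.2 i]].

Lemma emp_to_sample (R : realType) (S A n : nat) (X : 'I_S -> 'I_A -> 'I_n -> 'I_S) :
  emp R (to_sample X) = empirical R X.
Proof.
rewrite /emp; congr empirical; apply/funext => s; apply/funext => a; apply/funext => i.
by rewrite !ffunE.
Qed.

(** The event is a finite disjoint union of cells, each fixing all samples and confining all
    perturbations to [[0, xi]]. By independence a cell has probability [weight K x], the
    perturbation factors being 1. *)
Lemma sampling_event (R : realType) (S A n : nat) d (Omega : measurableType d)
    (Pr : probability Omega R) (K : 'I_S -> 'I_A -> 'I_S -> R) (xi : R)
    (X : Omega -> 'I_S -> 'I_A -> 'I_n -> 'I_S) (D : Omega -> 'I_S -> 'I_A -> R)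
    (P : pred (sample S A n)) :
  0 < xi -> sampling_model Pr K xi X D ->
  exists E : set Omega, [/\ measurable E, Pr E = (\sum_(x | P x) weight K x)%:E &
    forall w, E w -> P (to_sample (X w)) /\ forall s a, 0 <= D w s a <= xi].
Proof.
move=> xi0 [mX [mD [pX [pD indep]]]].
pose cell (x : sample S A n) := [set w |
  (forall s a i, [set x (s, a) i] (X w s a i)) /\ (forall s a, `[0, xi]%classic (D w s a))].
have mcell x : measurable (cell x).
  have -> : cell x =
      (\bigcap_(q in [set: 'I_S * 'I_A * 'I_n]) [set w | X w q.1.1 q.1.2 q.2 = x q.1 q.2]) `&`
      (\bigcap_(p in [set: 'I_S * 'I_A]) ((fun w => D w p.1 p.2) @^-1` `[0, xi])).
    apply/seteqP; split => w /=.
      by move=> [h1 h2]; split => [[[s a] i] _|[s a] _]; [exact: h1|exact: h2].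
    by move=> [h1 h2]; split => [s a i|s a]; [exact: (h1 (s, a, i) I)|exact: (h2 (s, a) I)].
  apply: measurableI; apply: fin_bigcap_measurable => //.
  by move=> p _; rewrite -[X in measurable X]setTI; exact: mD.
have pcell x : Pr (cell x) = (weight K x)%:E.
  rewrite /cell (indep (fun s a i => [set x (s, a) i]) (fun _ _ => `[0, xi]%classic))//.
  rewrite [X in (_ * X)%E](_ : _ = 1%E) ?mule1; last first.
    apply: big1 => s _; apply: big1 => a _; rewrite pD// setIid.
    rewrite lebesgue_measure_itv /= lte_fin xi0 oppr0 adde0 -EFinM mulVf//.
    by rewrite gt_eqF.
  have -> : weight K x = \prod_s \prod_a \prod_i K s a (x (s, a) i).
    by rewrite pair_bigA; apply: eq_bigr => -[s a].
  rewrite (big_morph EFin (@EFinM R) erefl); apply: eq_bigr => s _.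
  rewrite (big_morph EFin (@EFinM R) erefl); apply: eq_bigr => a _.
  rewrite (big_morph EFin (@EFinM R) erefl); apply: eq_bigr => i _.
  exact: pX.
exists (\bigcup_(x in [set` enum P]) cell x); split.
- by apply: fin_bigcup_measurable => // x _; exact: mcell.
- rewrite measure_fin_bigcup//; last first.
    move=> x y _ _ [w [[hx _] [hy _]]].
    by apply/ffunP => -[s a]; apply/ffunP => i; rewrite -(hx s a i) -(hy s a i).
  rewrite -fsbig_seq ?enum_uniq// big_enum_cond /= -sumEFin.
  by apply: eq_big => [x|x _]; rewrite ?andbT// pcell.
- move=> w [x /= Px [hx hD]]; rewrite mem_enum in Px; split.
    suff -> : to_sample (X w) = x by [].
    by apply/ffunP => -[s a]; apply/ffunP => i; rewrite !ffunE /= (hx s a i).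
  by move=> s a; have := hD s a; rewrite /= in_itv.
Qed.

(** * Values of policies, optimality, and the norms *)

Section Policies.
Variables (R : realType) (S A : nat).
Implicit Types (k : 'I_S -> 'I_A -> 'I_S -> R) (r pi : 'I_S -> 'I_A -> R).

Definition det (pi : 'I_S -> 'I_A) : 'I_S -> 'I_A -> R := fun s a => (a == pi s)%:R.

Lemma avg_det (pi : 'I_S -> 'I_A) f s : avg (det pi) f s = f s (pi s).
Proof.
rewrite /avg /expect /det (bigD1 (pi s))//= eqxx mul1r big1 ?addr0// => a /negbTE ->.
by rewrite mul0r.
Qed.

Lemma det_policy (pi : 'I_S -> 'I_A) : is_policy (det pi).
Proof.
split=> [s a|s]; first by rewrite /det.
rewrite (bigD1 (pi s))//= /det eqxx big1 ?addr0// => a /negbTE -> //.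
Qed.

Lemma vfun_ge0 (g : R) k r pi : 0 < g < 1 -> is_kernel k -> is_policy pi ->
  (forall s a, 0 <= r s a) -> forall s, 0 <= vfun g k r pi s.
Proof.
move=> g01 hk hpi r0; have hs := subkernel_of_kernel hk.
apply: (policy_super_unique g01 (k := k) (r := r) (pi := pi) (v := fun=> 0)) => // s; last first.
  by rewrite -vfunE.
apply: expect_ge_cst; first exact: is_dist_policy.
by move=> a; rewrite expect_cst ?mulr0 ?addr0//; exact: is_dist_kernel.
Qed.

Lemma vfun_le (g B : R) k r pi : 0 < g < 1 -> is_kernel k -> is_policy pi ->
  (forall s a, r s a <= B) -> forall s, vfun g k r pi s <= B * (1 - g)^-1.
Proof.
move=> g01 hk hpi rB; have hs := subkernel_of_kernel hk.
have g1 : 1 - g != 0 by rewrite gt_eqF// subr_gt0; case/andP: g01.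
apply: (policy_super_unique g01 (k := k) (r := r) (pi := pi) (w := fun=> B * (1 - g)^-1)) => // s.
  by rewrite -vfunE.
apply: expect_le_cst; first exact: is_dist_policy.
move=> a; rewrite expect_cst; last exact: is_dist_kernel.
by rewrite [leRHS](_ : _ = B + g * (B * (1 - g)^-1)) ?lerD2r//; field.
Qed.

Section Optimal.
Variables (g : R) (k : 'I_S -> 'I_A -> 'I_S -> R) (r : 'I_S -> 'I_A -> R) (B : R).
Hypotheses (g01 : 0 < g < 1) (hk : is_kernel k) (A0 : (0 < A)%N)
  (r0 : forall s a, 0 <= r s a) (B0 : 0 <= B) (rB : forall s a, r s a <= B).
Let hs := subkernel_of_kernel hk.

Lemma vfun_le_opt pi : is_policy pi -> forall s, vfun g k r pi s <= opt g k r s.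
Proof.
move=> hpi; apply: (opt_ge g01 hs A0 r0 B0 rB) => s; rewrite vfunE//.
exact: (avg_le_max (fun s a => r s a + g * expect (k s a) (vfun g k r pi))).
Qed.

Lemma opt_vfun : exists2 pi : 'I_S -> 'I_A,
  forall s, opt g k r s = r s (pi s) + g * expect (k s (pi s)) (opt g k r) &
  forall s, opt g k r s = vfun g k r (det pi) s.
Proof.
have [pi [piE _]] := opt_bellman g01 hs A0 r0 B0 rB.
exists pi => // s; apply/eqP; rewrite eq_le vfun_le_opt ?andbT; last exact: det_policy.
apply: (policy_super_unique g01 hs (r := r) (det_policy pi)) => t.
  by rewrite avg_det -piE.
by rewrite -vfunE//; exact: det_policy.
Qed.

(** Selecting a best action shows that every policy value is a subsolution, so [opt] is an upper
    bound; the greedy deterministic policy attains it. *)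
Lemma VstarE s : Vstar k r g s ord0 = opt g k r s.
Proof.
rewrite mxE; have [pi _ piE] := opt_vfun.
have ub : ubound [set value k r g p s 0 | p in is_policy (A := A)] (opt g k r s).
  by move=> _ [p hp <-]; exact: vfun_le_opt.
apply/eqP; rewrite eq_le; apply/andP; split.
  by apply: ge_sup => //; exists (value k r g (det pi) s 0), (det pi) => //; exact: det_policy.
rewrite piE; apply: ub_le_sup; first by exists (opt g k r s).
by exists (det pi) => //; exact: det_policy.
Qed.

Lemma optimal_opt pi : optimal k r g pi -> forall s, vfun g k r pi s = opt g k r s.
Proof.
move=> [hpi pim] s; have [pi' _ E] := opt_vfun.
apply/eqP; rewrite eq_le vfun_le_opt//= E; exact: (pim _ (det_policy pi')).
Qed.

End Optimal.

Lemma vfun_perturb (g xi : R) k r r' pi : 0 < g < 1 -> is_kernel k -> is_policy pi ->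
  (forall s a, r s a <= r' s a) -> (forall s a, r' s a <= r s a + xi) ->
  forall s, vfun g k r pi s <= vfun g k r' pi s <= vfun g k r pi s + xi * (1 - g)^-1.
Proof.
move=> g01 hk hpi r1 r2 s; have hs := subkernel_of_kernel hk.
have g1 : 1 - g != 0 by rewrite gt_eqF// subr_gt0; case/andP: g01.
have dpi t := is_dist_policy t hpi.
apply/andP; split.
  apply: (policy_super_unique g01 (k := k) (r := r) (pi := pi)) => // t; first by rewrite -vfunE.
  rewrite [leRHS]vfunE//; apply: expect_le => [a|a]; first by case: (dpi t).
  by rewrite lerD2r.
apply: (policy_super_unique g01 (k := k) (r := r') (pi := pi)
  (w := fun t => vfun g k r pi t + xi * (1 - g)^-1)) => // t; first by rewrite -vfunE.
set c := xi * (1 - g)^-1; have cE : g * c = c - xi by rewrite /c; field.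
rewrite [in leRHS]vfunE// -[X in _ <= _ + X](expect_cst c (dpi t)) -expectD.
apply: expect_le => [a|a]; first by case: (dpi t).
rewrite expectD expect_cst; last exact: is_dist_kernel.
by have := r2 t a; rewrite mulrDr cE; lra.
Qed.

Lemma le_spnorm (u : 'cV[R]_S) s t : u s ord0 - u t ord0 <= spnorm u.
Proof.
apply: le_trans (le_bigmax (0 : R) (fun s => \big[Num.max/0]_(t < S) (u s ord0 - u t ord0)) s).
exact: (le_bigmax (0 : R) (fun t => u s ord0 - u t ord0)).
Qed.

Lemma spnorm_ge0 (u : 'cV[R]_S) : 0 <= spnorm u.
Proof. exact: bigmax_ge_id. Qed.

Lemma spnorm_le (u : 'cV[R]_S) c : 0 <= c ->
  (forall s t, u s ord0 - u t ord0 <= c) -> spnorm u <= c.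
Proof. by move=> c0 uc; apply: bigmax_le => // s _; apply: bigmax_le. Qed.

Lemma supnorm_le (u : 'cV[R]_S) c : 0 <= c -> (forall s, `|u s ord0| <= c) -> supnorm u <= c.
Proof. by move=> c0 uc; apply: bigmax_le. Qed.

End Policies.

(** * The choice of the Bernstein scale *)

Section Rate.
Variables (R : realType) (n : nat) (L : R).
Hypotheses (n0 : (0 < n)%N) (L0 : 0 < L).

(** The [eta] at which the tilt error [eta * K] equals the Bernstein remainder [L / (eta * n%:R)];
    see [rate_inv]. *)
Definition rate (K : R) : R := Num.sqrt (L / (K * n%:R)).

Let nR : 0 < n%:R :> R. Proof. by rewrite ltr0n. Qed.

Lemma rate_gt0 K : 0 < K -> 0 < rate K.
Proof. by move=> K0; rewrite sqrtr_gt0 divr_gt0// mulr_gt0. Qed.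

Lemma rate_mul K : 0 < K -> rate K * K = Num.sqrt (L * K / n%:R).
Proof.
move=> K0; have -> : L * K / n%:R = K ^+ 2 * (L / (K * n%:R)).
  by field; rewrite !gt_eqF.
by rewrite sqrtrM ?sqr_ge0// sqrtr_sqr gtr0_norm// mulrC.
Qed.

Lemma rate_inv K : 0 < K -> L / (rate K * n%:R) = rate K * K.
Proof.
move=> K0; have r0 := rate_gt0 K0.
have r2 : rate K ^+ 2 = L / (K * n%:R).
  by rewrite sqr_sqrtr// ltW// divr_gt0// mulr_gt0.
have -> : L = rate K ^+ 2 * (K * n%:R) by rewrite r2; field; rewrite !gt_eqF.
by field; rewrite !gt_eqF.
Qed.

Lemma rate_mul_le K M : 0 < K -> K <= M -> rate K * K <= Num.sqrt (L * M / n%:R).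
Proof.
move=> K0 KM; rewrite rate_mul// ler_wsqrtr// ler_wpM2r ?invr_ge0 ?(ltW nR)//.
by rewrite ler_wpM2l// ltW.
Qed.

End Rate.

(** This is the function [F] of [value_le_empirical_value]. *)
Definition tilt (R : realType) (S : nat) (eta m : R) (V : 'I_S -> R) (s : 'I_S) : R :=
  V s + 8 * eta * (V s - m) ^+ 2.

Lemma tilt_range (R : realType) (S : nat) (eta m K : R) (V : 'I_S -> R) s t :
  0 < eta -> 1 <= K -> eta * K <= 16^-1 -> (forall s, m <= V s <= m + K) ->
  eta * (tilt eta m V s - tilt eta m V t) <= 1 / 2.
Proof.
move=> eta0 K1 etaK mV.
have [s0 sK] : 0 <= V s - m /\ V s - m <= K by have := mV s; lra.
have [t0 tK] : 0 <= V t - m /\ V t - m <= K by have := mV t; lra.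
apply: (@le_trans _ _ (eta * (K + 8 * (eta * K) * K))).
  rewrite ler_wpM2l ?(ltW eta0)// /tilt.
  have a1 : eta * (V s - m) ^+ 2 <= eta * K * K.
    by rewrite expr2 mulrA ler_pM// ?mulr_ge0 ?(ltW eta0)// ler_wpM2l ?(ltW eta0).
  have : 0 <= eta * (V t - m) ^+ 2 by rewrite mulr_ge0 ?sqr_ge0// ltW.
  by lra.
have e0 : 0 <= eta * K by rewrite mulr_ge0 ?(ltW eta0) ?(le_trans _ K1).
have : (eta * K) * (eta * K) <= 16^-1 * (eta * K) by rewrite ler_wpM2r.
rewrite mulrDr; have -> : eta * (8 * (eta * K) * K) = 8 * ((eta * K) * (eta * K)) by ring.
by lra.
Qed.

(** * The two comparisons for a sample without deviations *)

Lemma span_scaled_le2 (R : realType) (g K c : R) :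
  0 < g < 1 -> c <= (1 - g)^-1 -> K <= c + 1 -> (1 - g) * K <= 2.
Proof.
move=> /andP[g0 g1] cH Kc; have h : 0 < 1 - g by rewrite subr_gt0.
have : (1 - g) * K <= (1 - g) * ((1 - g)^-1 + 1).
  by rewrite ler_wpM2l ?(ltW h)//; lra.
by rewrite mulrDr divff ?gt_eqF// mulr1; lra.
Qed.

Lemma spnorm_value_le (R : realType) (S A : nat) (g : R) k r (pi : 'I_S -> 'I_A -> R) :
  0 < g < 1 -> is_kernel k -> is_policy pi -> (forall s a, 0 <= r s a <= 1) ->
  spnorm (value k r g pi) <= (1 - g)^-1.
Proof.
move=> g01 hk hpi r01; have h : 0 < 1 - g by rewrite subr_gt0; case/andP: g01.
apply: spnorm_le => [|s t]; first by rewrite invr_ge0 ltW.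
have r0 s' a : 0 <= r s' a by case/andP: (r01 s' a).
have r1 s' a : r s' a <= 1 by case/andP: (r01 s' a).
have := vfun_le g01 hk hpi r1 s; have := vfun_ge0 g01 hk hpi r0 t.
by rewrite /vfun; lra.
Qed.

Lemma spnorm_Vstar_le (R : realType) (S A : nat) (g : R) (k : 'I_S -> 'I_A -> 'I_S -> R) r :
  0 < g < 1 -> is_kernel k -> (0 < A)%N -> (forall s a, 0 <= r s a <= 1) ->
  spnorm (Vstar k r g) <= (1 - g)^-1.
Proof.
move=> g01 hk A0 r01.
have r0 s' a : 0 <= r s' a by case/andP: (r01 s' a).
have r1 s' a : r s' a <= 1 by case/andP: (r01 s' a).
have [pi _ piE] := opt_vfun g01 hk A0 r0 ler01 r1.
have <- : value k r g (det R pi) = Vstar k r g.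
  apply/colP => s; rewrite [RHS](VstarE g01 hk A0 r0 ler01 r1).
  by rewrite piE.
by apply: spnorm_value_le => //; exact: det_policy.
Qed.

(** The test function comes from the true optimal value and does not depend on the sample, so no
    freezing occurs. The sign in [- tilt] yields the lower deviation, and the constant 33 is 32 plus
    1 for the Bernstein remainder. *)
Lemma opt_le_empirical (R : realType) (S A n : nat) (g L : R)
    (k : 'I_S -> 'I_A -> 'I_S -> R) (r : 'I_S -> 'I_A -> R) (x : sample S A n) (z : 'I_S) :
  let K := spnorm (Vstar k r g) + 1 in
  let eta := rate n L K in
  (0 < n)%N -> (0 < A)%N -> 0 < g < 1 -> 0 < L -> is_kernel k ->
  (forall s a, 0 <= r s a <= 1) ->
  (forall s, opt g k r z <= opt g k r s) ->
  eta * K <= 16^-1 ->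
  (forall s a, ~~ deviates k eta L s a (fun t => - tilt eta (opt g k r z) (opt g k r) t) x) ->
  forall s, opt g k r s <= opt g (emp R x) r s + 33 * (eta * K) * (1 - g)^-1.
Proof.
move=> K eta n0 A0 g01 L0 hk r01 zmin etaK good s.
have r0 s' a : 0 <= r s' a by case/andP: (r01 s' a).
have r1 s' a : r s' a <= 1 by case/andP: (r01 s' a).
have hkh : is_kernel (emp R x) by exact: empirical_kernel.
have hsk := subkernel_of_kernel hk; have hskh := subkernel_of_kernel hkh.
have K1 : 1 <= K by rewrite lerDr spnorm_ge0.
have K0 : 0 < K by apply: lt_le_trans K1.
have eta0 : 0 < eta by exact: rate_gt0.
have eK0 : 0 <= eta * K by rewrite mulr_ge0 ?(ltW eta0) ?(ltW K0).
have VE t := VstarE g01 hk A0 r0 ler01 r1 t.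
have [pi piE _] := opt_vfun g01 hk A0 r0 ler01 r1.
have [_ [_ Ub]] := opt_bellman g01 hskh A0 r0 ler01 r1.
have etaK1 : eta * K <= 1 by apply: (le_trans etaK); lra.
have -> : 33 * (eta * K) = 32 * (eta * K) + eta * K by ring.
apply: (value_le_empirical_value (pi := pi) g01 hk hkh r01 K1 _ eta0 etaK eK0 etaK1
  (m := opt g k r z)).
- exact: (span_scaled_le2 g01 (spnorm_Vstar_le g01 hk A0 r01)).
- exact: (opt_ge0 g01 hsk A0 r0 ler01 r1).
- move=> t; rewrite zmin /= /K; have := le_spnorm (Vstar k r g) t z; rewrite !VE; lra.
- by move=> t; rewrite -piE.
- by move=> t; exact: Ub.
- move=> t a; pose T := tilt eta (opt g k r z) (opt g k r).
  change (expect (k t a) T - expect (emp R x t a) T <=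
    2 * eta * expect (k t a) (fun u => (T u - T t) ^+ 2) + eta * K).
  have := good t a; rewrite /deviates -leNgt -/T; move: T => T.
  rewrite !expectN rate_inv// => dev.
  have := variance_le (fun u => - T u) (- T t) (is_dist_kernel t a hk).
  rewrite !expectN => /(ler_wpM2l (ltW eta0)).
  have -> : expect (k t a) (fun u => (- T u - - T t) ^+ 2) =
      expect (k t a) (fun u => (T u - T t) ^+ 2).
    by apply: eq_expect => u; ring.
  by move: dev; rewrite -/eta; lra.
Qed.

(** The depth [K] is rounded up to an integer, so that a union bound over finitely many depths
    suffices; it still exceeds the smaller span strictly. *)
Lemma empirical_le_value (R : realType) (S A n : nat) (g L : R)
    (k : 'I_S -> 'I_A -> 'I_S -> R) (r : 'I_S -> 'I_A -> R) (x : sample S A n)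
    (pi : 'I_S -> 'I_A -> R) (vt : 'I_S -> R) :
  let v := vfun g (emp R x) r pi in
  let i := Num.trunc (Num.min (spnorm (value (emp R x) r g pi)) (spnorm (value k r g pi))) in
  let K := i.+1%:R in
  let eta := rate n L K in
  (0 < n)%N -> (0 < A)%N -> 0 < g < 1 -> 0 < L -> is_kernel k ->
  (forall s a, 0 <= r s a <= 1) -> is_policy pi ->
  (forall s a, r s a + g * expect (emp R x s a) vt <= vt s) ->
  (forall s, v s <= vt s <= v s + n%:R^-1) ->
  eta * K <= 16^-1 -> n%:R^-1 <= 16^-1 :> R ->
  (forall s a (j : nat), (j < (Num.trunc (n%:R * (1 - g)^-1)).+1)%N ->
     ~~ deviates k eta L s a (clip K (frozen_opt g (emp R x) r s a (j%:R / n%:R))) x) ->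
  forall s, v s <= vfun g k r pi s + (41 * (eta * K) + 3 * n%:R^-1) * (1 - g)^-1.
Proof.
move=> v i K eta n0 A0 g01 L0 hk r01 hpi vtb vvt etaK n16 good s.
have r0 s' a : 0 <= r s' a by case/andP: (r01 s' a).
have r1 s' a : r s' a <= 1 by case/andP: (r01 s' a).
have hkh : is_kernel (emp R x) by exact: empirical_kernel.
have hsk := subkernel_of_kernel hk; have hskh := subkernel_of_kernel hkh.
have nR : 0 < n%:R :> R by rewrite ltr0n.
have nV : 0 <= n%:R^-1 :> R by rewrite invr_ge0 ltW.
have nV1 : n%:R^-1 <= 1 :> R by rewrite invf_le1// ler1n.
have K1 : 1 <= K by rewrite ler1n.
have K0 : 0 < K by apply: lt_le_trans K1.
have eta0 : 0 < eta by exact: rate_gt0.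
have eK0 : 0 <= eta * K by rewrite mulr_ge0 ?(ltW eta0) ?(ltW K0).
pose sp := Num.min (spnorm (value (emp R x) r g pi)) (spnorm (value k r g pi)).
have sp0 : 0 <= sp by rewrite le_min !spnorm_ge0.
have spK : sp < K by have /andP[_] := truncn_itv sp0.
have isp : i%:R <= sp by case/andP: (truncn_itv sp0).
have Ksp : K <= sp + 1 by rewrite /K -[i.+1]addn1 natrD lerD2r.
have spH : sp <= (1 - g)^-1 by rewrite ge_min spnorm_value_le.
have v0 t : 0 <= v t by exact: vfun_ge0.
have vH t : v t <= (1 - g)^-1 by rewrite -[leRHS]mul1r; exact: vfun_le.
have [z zE] := vmax_attained s v0.
have vz t : v t <= v z by rewrite -zE vmax_ge.
have g0 : 0 <= g by case/andP: g01 => /ltW.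
have g1 : 0 < 1 - g by rewrite subr_gt0; case/andP: g01.
have vE t : v t <= avg pi (fun s a => r s a + g * expect (emp R x s a) v) t by rewrite -vfunE.
have -> : 41 * (eta * K) + 3 * n%:R^-1 = 40 * (eta * K) + (eta * K + 3 * n%:R^-1) by ring.
apply: (@empirical_value_le_value R S A g k (emp R x) r K eta (eta * K + 3 * n%:R^-1) pi v
  (vfun g k r pi) z g01 hk hkh r01 K1 (span_scaled_le2 g01 spH Ksp) eta0 etaK) => //.
- by rewrite addr_ge0// mulr_ge0.
- by lra.
- by move=> t; rewrite -vfunE.
- move=> t a; rewrite -[v z]zE.
  set Q := r t a + g * expect (emp R x t a) v.
  have Q0 : 0 <= Q.
    rewrite addr_ge0// mulr_ge0//; apply: expect_ge0 => // u; by case: hkh.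
  have QH : Q <= (1 - g)^-1.
    have := expect_le_cst (is_dist_kernel t a hkh) vH => /(ler_wpM2l g0) h.
    have e : (1 - g)^-1 = 1 + g * (1 - g)^-1 by field; rewrite gt_eqF.
    by rewrite e; apply: lerD.
  have nQ0 : 0 <= n%:R * Q by rewrite mulr_ge0 ?(ltW nR).
  have /andP[jl ju] := truncn_itv nQ0; set j := Num.trunc (n%:R * Q) in jl ju.
  have jlt : (j < (Num.trunc (n%:R * (1 - g)^-1)).+1)%N.
    by rewrite ltnS le_truncn// ler_wpM2l ?(ltW nR).
  set W := frozen_opt g (emp R x) r t a (j%:R / n%:R).
  have j0 : 0 <= j%:R / n%:R :> R by rewrite divr_ge0// ltW.
  have vW u : `|v u - W u| <= n%:R^-1.
    apply: (frozen_opt_close (vt := vt) g01 hkh A0 r01 hpi) => //.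
    - by move=> y; case/andP: (vvt y).
    - by move=> y; case/andP: (vvt y).
    - rewrite -/Q ler_pdivrMr// mulrC jl /=.
      rewrite -[X in _ + X]mul1r -mulrDl ler_pdivlMr// mulrC ltW//.
      by rewrite natr1.
  have W0 u : 0 <= W u by exact: frozen_opt_ge0.
  apply: (@deviation_transfer R 'I_S (k t a) (emp R x t a) (clip K v) (clip K W) K eta
    (eta * K) n%:R^-1 t) => //.
  + exact: is_dist_kernel.
  + exact: is_dist_kernel.
  + by move=> u; apply: clip_close.
  + by move=> u u'; apply: clip_range; exact: ltW.
  + by have := good t a j jlt; rewrite /deviates -leNgt rate_inv.
(* If the empirical span is the smaller one, [K] exceeds it and [v] is never clipped; otherwise [K]
   exceeds the span of the true value of [pi]. *)
- have [h|h] := leP (spnorm (value (emp R x) r g pi)) (spnorm (value k r g pi)).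
    left=> t; have := le_spnorm (value (emp R x) r g pi) z t.
    by rewrite /sp (min_idPl h) in spK; rewrite -/(vfun g (emp R x) r pi z) -/(vfun g (emp R x) r pi t) -/v; lra.
  right=> t u; have := le_spnorm (value k r g pi) t u.
  by rewrite /sp (min_idPr (ltW h)) in spK; rewrite /vfun; lra.
Qed.

(** * Counting the events and assembling the bound *)

Lemma ln_ge_half (R : realType) (y : R) : 2 <= y -> 1 / 2 <= ln y.
Proof.
move=> y2; rewrite -(expRK (1 / 2 : R)) ler_ln ?posrE ?expR_gt0//; last lra.
have h : (1 / 2 : R) <= 1 / 2 by [].
apply: le_trans y2; apply: (le_trans (expR_le_quad h)); rewrite expr2; lra.
Qed.

(** With [a] pairs, [nu] samples and horizon [H], put [X = a * nu * H]. There are at most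
    [5 * X ^+ 2] events, each of probability at most [(delta / X) ^+ 5], and [X ^+ 3 >= 8] absorbs
    the 5. *)
Lemma card_tail_le (R : realType) (a nu H NK NJ delta : R) :
  1 <= a -> 1 <= nu -> 1 <= H -> 0 <= NK -> NK <= H + 1 -> 0 <= NJ -> NJ <= nu * H + 1 ->
  2 <= a * nu * H -> 0 < delta < 1 ->
  (a + a * (NK * NJ)) * expR (- (5 * ln (a * nu * H / delta))) <= delta.
Proof.
move=> a1 nu1 H1 NK0 NKH NJ0 NJH X2 /andP[d0 d1].
set X := a * nu * H in X2 *.
have X0 : 0 < X by lra.
have y0 : 0 < X / delta by rewrite divr_gt0.
rewrite expRN -[5]/(5%:R) expRM_natl lnK ?posrE// ler_pdivrMr ?exprn_gt0//.
have aX : a <= X.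
  rewrite /X -mulrA ler_peMr//; first lra.
  by rewrite -[1]mulr1 ler_pM.
have nuH1 : 1 <= nu * H by rewrite -[1]mulr1 ler_pM.
have HX : H <= X by rewrite /X ler_peMl//; [lra|rewrite -[1]mulr1 ler_pM].
have count : a + a * (NK * NJ) <= 5 * X ^+ 2.
  have h : NK * NJ <= (2 * H) * (2 * (nu * H)) by apply: ler_pM => //; lra.
  have h2 : a * (NK * NJ) <= a * ((2 * H) * (2 * (nu * H))) by rewrite ler_wpM2l//; lra.
  have e : a * ((2 * H) * (2 * (nu * H))) = 4 * (X * H) by rewrite /X; ring.
  have h3 : X * H <= X * X by rewrite ler_wpM2l// ltW.
  have h4 : X * 1 <= X * X by rewrite ler_wpM2l//; lra.
  by rewrite expr2; lra.
apply: (le_trans count).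
have -> : delta * (X / delta) ^+ 5 = X ^+ 2 * (X ^+ 3 * delta^-1 ^+ 4).
  by field; rewrite gt_eqF.
rewrite mulrC ler_wpM2l ?sqr_ge0//.
have X3 : 8 <= X ^+ 3.
  by rewrite [8](_ : _ = 2 ^+ 3); [apply: lerXn2r; rewrite ?nnegrE ?(ltW X0) | ring].
have dV : 1 <= delta^-1 ^+ 4 by rewrite exprn_ege1// invf_ge1// ltW.
by apply: (@le_trans _ _ (8 * 1)); [lra | apply: ler_pM].
Qed.

(** In units of [rho / (1 - g)], passing to the empirical optimum costs 33, removing the
    perturbation 1, and returning to the true value of [pi] 44; the sum 78 is rounded to 100. *)
Lemma optimal_gap_le (R : realType) (S A n : nat) (g L : R)
    (k : 'I_S -> 'I_A -> 'I_S -> R) (r D : 'I_S -> 'I_A -> R) (x : sample S A n)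
    (pi : 'I_S -> 'I_A -> R) (z : 'I_S) :
  let KA := spnorm (Vstar k r g) + 1 in
  let m := Num.min (spnorm (value (emp R x) r g pi)) (spnorm (value k r g pi)) in
  let rho := Num.sqrt (L * (spnorm (Vstar k r g) + m + 1) / n%:R) in
  (0 < n)%N -> (0 < A)%N -> 0 < g < 1 -> 1 <= L -> is_kernel k ->
  (forall s a, 0 <= r s a <= 1) ->
  (forall s a, 0 <= D s a <= (1 - g) / (2 * n%:R)) ->
  optimal (emp R x) (fun s a => r s a + D s a) g pi ->
  (forall s, opt g k r z <= opt g k r s) ->
  rho <= 16^-1 ->
  (forall s a, rate n L KA * KA <= 16^-1 ->
    ~~ deviates k (rate n L KA) L s a
         (fun t => - tilt (rate n L KA) (opt g k r z) (opt g k r) t) x) ->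
  (forall s a (i j : nat), (i < (Num.trunc (1 - g)^-1).+1)%N ->
     (j < (Num.trunc (n%:R * (1 - g)^-1)).+1)%N -> rate n L i.+1%:R * i.+1%:R <= 16^-1 ->
     ~~ deviates k (rate n L i.+1%:R) L s a
          (clip i.+1%:R (frozen_opt g (emp R x) r s a (j%:R / n%:R))) x) ->
  forall s, opt g k r s - vfun g k r pi s <= (1 - g)^-1 * (100 * rho).
Proof.
move=> KA m rho n0 A0 g01 L1 hk r01 hD hopt zmin rho16 goodA goodB s.
have r0 s' a : 0 <= r s' a by case/andP: (r01 s' a).
have r1 s' a : r s' a <= 1 by case/andP: (r01 s' a).
have hkh : is_kernel (emp R x) by exact: empirical_kernel.
have hskh := subkernel_of_kernel hkh.
have nR : 0 < n%:R :> R by rewrite ltr0n.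
have n1 : 1 <= n%:R :> R by rewrite ler1n.
have L0 : 0 < L by apply: lt_le_trans L1.
have g0 : 0 <= g by case/andP: g01 => /ltW.
have gp : 0 < 1 - g by rewrite subr_gt0; case/andP: g01.
have H1 : 1 <= (1 - g)^-1 by rewrite invf_ge1//; lra.
have hpi := hopt.1.
have m0 : 0 <= m by rewrite le_min !spnorm_ge0.
have sp0 := spnorm_ge0 (Vstar k r g).
set M := spnorm (Vstar k r g) + m + 1 in rho rho16 *.
have KAM : KA <= M by rewrite /KA /M; lra.
have KA0 : 0 < KA by rewrite /KA; lra.
have rA : rate n L KA * KA <= rho by exact: rate_mul_le.
pose i := Num.trunc m.
have iM : i%:R <= m by case/andP: (truncn_itv m0).
have KBM : i.+1%:R <= M :> R by rewrite -natr1 /M; lra.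
have rB : rate n L i.+1%:R * i.+1%:R <= rho by apply: rate_mul_le => //; rewrite ltr0n.
have mH : m <= (1 - g)^-1 by rewrite ge_min spnorm_value_le.
have iH : (i < (Num.trunc (1 - g)^-1).+1)%N by rewrite ltnS le_truncn.
have nV1 : n%:R^-1 <= 1 :> R by rewrite invf_le1.
have nV0 : 0 <= n%:R^-1 :> R by rewrite invr_ge0 ltW.
(* The square of [1/n] is at most [1/n], and both [L] and [M] are at least 1. *)
have nrho : n%:R^-1 <= rho.
  rewrite -[leLHS]ger0_norm// -sqrtr_sqr ler_wsqrtr// expr2 ler_wpM2r//.
  by apply: (le_trans nV1); rewrite -[1]mulr1 ler_pM// /M; lra.
have rt0 t a : 0 <= r t a + D t a by rewrite addr_ge0//; case/andP: (hD t a).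
have Dc : (1 - g) / (2 * n%:R) <= 1.
  rewrite ler_pdivrMr ?mulr_gt0// mul1r; lra.
have rt2 t a : r t a + D t a <= 2 by have := hD t a; have := r1 t a; lra.
have vtE := optimal_opt g01 hkh A0 rt0 (ler0n R 2) rt2 hopt.
set vt := opt g (emp R x) _ in vtE.
have [_ [_ vtb]] := opt_bellman g01 hskh A0 rt0 (ler0n R 2) rt2.
rewrite -/vt in vtb.
have vtb' t a : r t a + g * expect (emp R x t a) vt <= vt t.
  by have := vtb t a; have := hD t a; lra.
have rD1 t a : r t a <= r t a + D t a by have := hD t a; lra.
have rD2 t a : r t a + D t a <= r t a + (1 - g) / (2 * n%:R) by have := hD t a; lra.
(* A reward change of at most [(1 - g) / (2 * n%:R)] moves a discounted value by at most
   [1 / (2n)]. *)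
have vvt t : vfun g (emp R x) r pi t <= vt t <= vfun g (emp R x) r pi t + n%:R^-1.
  have /andP[h1 h2] := vfun_perturb g01 hkh hpi rD1 rD2 t.
  rewrite -vtE h1 /=; apply: (le_trans h2); rewrite lerD2l.
  have -> : (1 - g) / (2 * n%:R) / (1 - g) = n%:R^-1 / 2.
    by field; rewrite !gt_eqF.
  by rewrite ler_pdivrMr//; lra.
have hA := opt_le_empirical n0 A0 g01 L0 hk r01 zmin (le_trans rA rho16)
  (fun s a => goodA s a (le_trans rA rho16)) s.
have hB := empirical_le_value n0 A0 g01 L0 hk r01 hpi vtb' vvt (le_trans rB rho16)
  (le_trans nrho rho16) (fun s a j hj => goodB s a i j iH hj (le_trans rB rho16)) s.
have hC : opt g (emp R x) r s <= vt s := opt_le g01 hskh A0 r0 ler01 r1 vtb' s.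
have /andP[_ hV] := vvt s.
have H0 : 0 <= (1 - g)^-1 by rewrite invr_ge0 ltW.
have a1 : 33 * (rate n L KA * KA) * (1 - g)^-1 <= 33 * rho * (1 - g)^-1.
  by rewrite ler_wpM2r//; lra.
have a2 : (41 * (rate n L i.+1%:R * i.+1%:R) + 3 * n%:R^-1) * (1 - g)^-1 <= 44 * rho * (1 - g)^-1.
  by rewrite ler_wpM2r//; lra.
have rho0 : 0 <= rho by exact: sqrtr_ge0.
have a3 : rho <= rho * (1 - g)^-1 by rewrite ler_peMr.
rewrite -/KA in hA; rewrite -/m -/i in hB.
by move: hA hB hC hV a1 a2 a3 nrho rho0; lra.
Qed.

(** There is only one policy. This covers [S * A * n = 1], where the logarithm of the bound can be
    arbitrarily close to 0 and the error has to vanish exactly. *)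
Lemma single_action_opt (R : realType) (S : nat) (g : R)
    (k : 'I_S -> 'I_1 -> 'I_S -> R) r pi :
  0 < g < 1 -> is_kernel k -> is_policy pi -> (forall s a, 0 <= r s a <= 1) ->
  forall s, vfun g k r pi s = opt g k r s.
Proof.
move=> g01 hk hpi r01 s.
have r0 s' a : 0 <= r s' a by case/andP: (r01 s' a).
have r1 s' a : r s' a <= 1 by case/andP: (r01 s' a).
have [p _ ->] := opt_vfun g01 hk (ltn0Sn 0) r0 ler01 r1.
suff -> : pi = det R p by [].
apply/funext => t; apply/funext => a; rewrite !ord1 /det (ord1 (p t)) eqxx.
by case: hpi => _ /(_ t); rewrite big_ord1.
Qed.

Lemma good_samples (R : realType) (S A n : nat) (g delta : R)
    (k : 'I_S -> 'I_A -> 'I_S -> R) (r : 'I_S -> 'I_A -> R) (z : 'I_S) :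
  let L := 5 * ln ((S * A * n)%:R / ((1 - g) * delta)) in
  let KA := spnorm (Vstar k r g) + 1 in
  (0 < n)%N -> (0 < A)%N -> (1 < S * A * n)%N -> 0 < g < 1 -> 0 < delta < 1 -> is_kernel k ->
  (forall s a, 0 <= r s a <= 1) ->
  (forall s, opt g k r z <= opt g k r s) ->
  exists good : pred (sample S A n), 1 - delta <= \sum_(x | good x) weight k x /\
  forall x, good x ->
  (forall s a, rate n L KA * KA <= 16^-1 ->
    ~~ deviates k (rate n L KA) L s a
         (fun t => - tilt (rate n L KA) (opt g k r z) (opt g k r) t) x) /\
  (forall s a (i j : nat), (i < (Num.trunc (1 - g)^-1).+1)%N ->
     (j < (Num.trunc (n%:R * (1 - g)^-1)).+1)%N -> rate n L i.+1%:R * i.+1%:R <= 16^-1 ->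
     ~~ deviates k (rate n L i.+1%:R) L s a
          (clip i.+1%:R (frozen_opt g (emp R x) r s a (j%:R / n%:R))) x).
Proof.
move=> L KA n0 A0 SAn g01 d01 hk r01 zmin.
have r0 s' a : 0 <= r s' a by case/andP: (r01 s' a).
have r1 s' a : r s' a <= 1 by case/andP: (r01 s' a).
have nR : 0 < n%:R :> R by rewrite ltr0n.
have gp : 0 < 1 - g by rewrite subr_gt0; case/andP: g01.
have g0 : 0 < g by case/andP: g01.
have H1 : 1 <= (1 - g)^-1 by rewrite invf_ge1//; lra.
have H0 : 0 <= (1 - g)^-1 by rewrite invr_ge0 ltW.
have d0 : 0 < delta by case/andP: d01.
have d1 : delta < 1 by case/andP: d01.
pose NK := (Num.trunc (1 - g)^-1).+1; pose NJ := (Num.trunc (n%:R * (1 - g)^-1)).+1.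
pose J : finType := (('I_S * 'I_A) + ('I_S * 'I_A) * ('I_NK * 'I_NJ))%type.
pose bad (j : J) (x : sample S A n) := match j with
  | inl p => (rate n L KA * KA <= 16^-1) && deviates k (rate n L KA) L p.1 p.2
      (fun t => - tilt (rate n L KA) (opt g k r z) (opt g k r) t) x
  | inr (p, q) => (rate n L (q.1 : nat).+1%:R * (q.1 : nat).+1%:R <= 16^-1) &&
      deviates k (rate n L (q.1 : nat).+1%:R) L p.1 p.2
        (clip (q.1 : nat).+1%:R (frozen_opt g (emp R x) r p.1 p.2 ((q.2 : nat)%:R / n%:R))) x
  end.
pose good (x : sample S A n) := [forall j, ~~ bad j x].
have X2 : 2 <= (S * A)%:R * n%:R * (1 - g)^-1 :> R.
  by rewrite -natrM -[2]mulr1 ler_pM ?ler0n// ler_nat.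
have L0 : 0 < L.
  rewrite /L mulr_gt0// (lt_le_trans _ (ln_ge_half _))//.
  have -> : (S * A * n)%:R / ((1 - g) * delta) = (S * A)%:R * n%:R * (1 - g)^-1 / delta :> R.
    by rewrite natrM; field; rewrite !gt_eqF.
  rewrite ler_pdivlMr//; apply: le_trans X2; rewrite -[leRHS]mulr1 ler_wpM2l// ltW//.
have badP j : \sum_(x | bad j x) weight k x <= expR (- L).
  (* An event whose guard on [rate] fails is empty; the guard provides the range condition of
     [deviates_le]. *)
  have off (c : bool) (P : pred (sample S A n)) :
      (c -> \sum_(x | P x) weight k x <= expR (- L)) ->
      \sum_(x | c && P x) weight k x <= expR (- L).
    by case: c => h; [exact: h | rewrite big_pred0_eq expR_ge0].
  case: j => [[s a]|[[s a] [i j]]] /=; apply: off => etaK.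
  - have KA1 : 1 <= KA by rewrite lerDr spnorm_ge0.
    have KA0 : 0 < KA by apply: lt_le_trans KA1.
    have eta0 := rate_gt0 n0 L0 KA0.
    apply: (@deviates_le R S A n n0 k hk (rate n L KA) L s a
      (fun _ t => - tilt (rate n L KA) (opt g k r z) (opt g k r) t)) => // x t u.
    rewrite opprK addrC; apply: (tilt_range _ _ eta0 KA1 etaK) => v.
    rewrite zmin /= /KA; have := le_spnorm (Vstar k r g) v z.
    by rewrite !(VstarE g01 hk A0 r0 ler01 r1); lra.
  - have K0 : 0 < (i : nat).+1%:R :> R by rewrite ltr0n.
    have eta0 := rate_gt0 n0 L0 K0.
    apply: (@deviates_le R S A n n0 k hk (rate n L (i : nat).+1%:R) L s a
      (fun x => clip (i : nat).+1%:R (frozen_opt g (emp R x) r s a ((j : nat)%:R / n%:R)))) => //.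
      move=> x y; rewrite /frozen_opt (@freeze_kernel_eq _ _ _ (emp R (update x (s, a) y)) (emp R x))//.
      move=> s' a' ne; have e : update x (s, a) y (s', a') = x (s', a').
        by rewrite ffunE (negbTE ne).
      by rewrite /emp /empirical e.
    move=> x t u; apply: (le_trans (_ : _ <= rate n L (i : nat).+1%:R * (i : nat).+1%:R)).
      by rewrite ler_wpM2l ?(ltW eta0)// clip_range// ltW.
    by apply: (le_trans etaK); lra.
exists good; split.
  have w0 (x : sample S A n) : 0 <= weight k x by exact: weight_ge0.
  have tot := sum_weight n hk.
  rewrite (bigID good) /= in tot.
  suff : \sum_(x | ~~ good x) weight k x <= delta by move: tot; lra.
  have gb x : ~~ good x -> exists j, bad j x.
    by move=> /forallPn[j]; rewrite negbK => ?; exists j.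
  have ub := union_bound w0 gb badP.
  apply: (le_trans ub).
  have -> : #|J|%:R = (S * A)%:R + (S * A)%:R * (NK%:R * NJ%:R) :> R.
    by rewrite card_sum !card_prod !card_ord natrD [in X in _ + X]natrM [(NK * NJ)%:R]natrM.
  have -> : L = 5 * ln ((S * A)%:R * n%:R * (1 - g)^-1 / delta).
    by rewrite /L; congr (_ * ln _); rewrite natrM; field; rewrite !gt_eqF.
  apply: card_tail_le => //.
  - by rewrite ler1n lt0n; apply: contraTneq SAn => ->; rewrite mul0n.
  - by rewrite ler1n.
  - by rewrite -natr1 lerD2r truncn_le.
  - by rewrite -natr1 lerD2r truncn_le mulr_ge0// ltW.
move=> x /forallP gx; split=> [s a h|s a i j hi hj h].
  by have := gx (inl (s, a)); rewrite /bad /= h.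
by have := gx (inr ((s, a), (Ordinal hi, Ordinal hj))); rewrite /bad /= h.
Qed.

Theorem mainTheorem10 :
  exists C : nat, (0 < C)%N /\
  forall (R : realType) (S A n : nat), (0 < S)%N -> (0 < A)%N -> (0 < n)%N ->
  forall (K : 'I_S -> 'I_A -> 'I_S -> R) (r : 'I_S -> 'I_A -> R),
  is_kernel K -> (forall s a, 0 <= r s a <= 1) ->
  forall (gamma delta : R), 0 < gamma < 1 -> 0 < delta < 1 ->
  let xi := (1 - gamma) / (2 * n%:R) in
  forall (d : measure_display) (Omega : measurableType d) (Pr : probability Omega R)
    (X : Omega -> 'I_S -> 'I_A -> 'I_n -> 'I_S) (D : Omega -> 'I_S -> 'I_A -> R),
  sampling_model Pr K xi X D ->
  forall pihat : Omega -> 'I_S -> 'I_A -> R,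
  (forall w, optimal (empirical R (X w)) (fun s a => r s a + D w s a) gamma (pihat w)) ->
  exists E : set Omega, measurable E /\ ((1 - delta)%:E <= Pr E)%E /\
  forall w, E w ->
    supnorm (value K r gamma (pihat w) - Vstar K r gamma) <=
    (1 - gamma)^-1 *
    Num.sqrt (C%:R * (ln ((S * A * n)%:R / ((1 - gamma) * delta))) ^+ 3 / n%:R
       * (spnorm (Vstar K r gamma)
          + Num.min (spnorm (value (empirical R (X w)) r gamma (pihat w)))
                    (spnorm (value K r gamma (pihat w)))
          + 1)).
Proof.
(* [500 = 100 * 5]: the 100 is from [optimal_gap_le], and [25 * ln y ^+ 3] dominates [5 * ln y] once
   [ln y >= 1 / 2]. *)
exists (500 ^ 2)%N; split; first by rewrite expn_gt0.
move=> R S A n S0 A0 n0 k r hk r01 g delta g01 d01 xi d Omega Pr X D model pihat hopt.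
have gp : 0 < 1 - g by rewrite subr_gt0; case/andP: g01.
have g0 : 0 < g by case/andP: g01.
have nR : 0 < n%:R :> R by rewrite ltr0n.
have H0 : 0 <= (1 - g)^-1 by rewrite invr_ge0 ltW.
have r0 s' a : 0 <= r s' a by case/andP: (r01 s' a).
have r1 s' a : r s' a <= 1 by case/andP: (r01 s' a).
have VE t := VstarE g01 hk A0 r0 ler01 r1 t.
(* When [S * A * n >= 2] the argument of the logarithm is at least 2, so the logarithm is bounded
   below. *)
have [SAn|SAn] := leqP (S * A * n)%N 1; last first.
  have xi0 : 0 < xi by rewrite divr_gt0// mulr_gt0.
  have [z zm] := argmaxP (fun s => - opt g k r s) (Ordinal S0).
  have zmin s : opt g k r z <= opt g k r s by have := zm s; lra.
  have [good [pgood goodP]] := good_samples n0 A0 SAn g01 d01 hk r01 zmin.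
  have [E [mE PE EP]] := sampling_event good xi0 model.
  exists E; split=> //; split; first by rewrite PE lee_fin.
  move=> w /EP[gw Dw].
  set y : R := (S * A * n)%:R / ((1 - g) * delta) in goodP *.
  have L2 : 1 / 2 <= ln y.
    apply: ln_ge_half; rewrite ler_pdivlMr; last by rewrite mulr_gt0//; case/andP: d01.
    apply: (@le_trans _ _ 2%:R); last by rewrite ler_nat.
    have /andP[d0 d1] := d01.
    by rewrite ler_piMr// mulr_ile1// ?(ltW gp) ?(ltW d0) ?(ltW d1)//; lra.
  set sV := spnorm (Vstar k r g); set m := Num.min _ _.
  have [hA hB] := goodP _ gw.
  have sV0 : 0 <= sV by exact: spnorm_ge0.
  have m0 : 0 <= m by rewrite le_min !spnorm_ge0.
  set M := sV + m + 1.
  have M1 : 1 <= M by rewrite /M; lra.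
  have MnV : 0 <= M / n%:R by rewrite divr_ge0 ?(ltW nR)//; lra.
  have hpi := (hopt w).1.
  set rho := Num.sqrt (5 * ln y * M / n%:R).
  have rho0 : 0 <= rho by exact: sqrtr_ge0.
  have gap s : opt g k r s - vfun g k r (pihat w) s <= (1 - g)^-1 * (100 * rho).
    have [rho16|rho16] := leP rho 16^-1.
      move: hA hB rho16; rewrite /rho /M /m -emp_to_sample => hA hB rho16.
      have L1 : 1 <= 5 * ln y by lra.
      apply: (optimal_gap_le (D := D w) n0 A0 g01 L1 hk r01 (Dw : forall s a, _) _ zmin rho16 hA hB).
      by rewrite emp_to_sample; exact: hopt.
    (* For [rho > 16^-1] the claim is trivial: both values lie in [[0, 1 / (1 - g)]] and
       [100 * rho >= 1]. *)
    have := vfun_ge0 g01 hk hpi r0 s.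
    have [p _ pE] := opt_vfun g01 hk A0 r0 ler01 r1.
    have := vfun_le g01 hk (det_policy R p) r1 s; rewrite -pE mul1r.
    have : (1 - g)^-1 * 1 <= (1 - g)^-1 * (100 * rho) by rewrite ler_wpM2l//; lra.
    by rewrite mulr1; lra.
  have sqrt_le : 100 * rho <= Num.sqrt ((500 ^ 2)%N%:R * ln y ^+ 3 / n%:R * M).
    have h100 : 0 <= 100 :> R by [].
    rewrite -(ger0_norm h100) -sqrtr_sqr -sqrtrM ?sqr_ge0// ler_wsqrtr// natrX.
    have -> : 500 = 100 * 5 :> R by ring.
    rewrite exprMn; move: (100 ^+ 2) (sqr_ge0 (100 : R)) => c c0.
    have -> : c * (5 * ln y * M / n%:R) = c * (5 * ln y) * (M / n%:R) by ring.
    have -> : c * 5 ^+ 2 * ln y ^+ 3 / n%:R * M = c * (25 * ln y ^+ 3) * (M / n%:R) by ring.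
    rewrite ler_wpM2r// ler_wpM2l//.
    have l2 : 1 / 4 <= ln y ^+ 2.
      have -> : 1 / 4 = (1 / 2) ^+ 2 :> R by field.
      by apply: lerXn2r; rewrite ?nnegrE//; lra.
    have ly : 0 <= ln y by lra.
    have := ler_wpM2l ly l2; rewrite -exprS; lra.
  move: (Num.sqrt (_ * M)) sqrt_le => B rhoB.
  have B0 : 0 <= B by apply: le_trans rhoB; rewrite mulr_ge0.
  apply: supnorm_le => [|s]; first exact: mulr_ge0.
  rewrite [X in `|X|](_ : _ = vfun g k r (pihat w) s - opt g k r s); last first.
    by rewrite -VE [LHS]mxE [X in _ + X = _]mxE.
  rewrite distrC ger0_norm; last by rewrite subr_ge0 (vfun_le_opt g01 hk A0 r0 ler01 r1).
  by apply: (le_trans (gap s)); rewrite ler_wpM2l.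
have A1 : A = 1%N.
  apply/eqP; rewrite eqn_leq A0 andbT; apply: leq_trans SAn.
  by rewrite mulnAC leq_pmull// muln_gt0 S0.
subst A; exists [set: Omega]; split=> //; split.
  by rewrite probability_setT lee_fin; case/andP: d01 => d0 _; lra.
move=> w _; apply: (@le_trans _ _ 0); last exact: (mulr_ge0 H0 (sqrtr_ge0 _)).
apply: supnorm_le => // s.
rewrite [X in `|X|](_ : _ = vfun g k r (pihat w) s - opt g k r s); last by rewrite -VE [LHS]mxE [X in _ + X = _]mxE.
by rewrite single_action_opt ?subrr ?normr0//; exact: (hopt w).1.
Qed.
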